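(* Let $d\ge 1$, let $\vec w^1,\vec w^2,\ldots\in\mathbb N^d$ be a sequence of vectors with $\vec w^j=(w^j_1,\ldots,w^j_d)$, and let $p_1,p_2,\ldots\in\mathbb R^+$ (positive reals) satisfy $$\gcd(w^1_i,w^2_i,\ldots)=1\ \text{ for all } i=1,\ldots,d,\qquad\text{and}\qquad \sum_{j=1}^\infty p_j=1 .$$ Then, given any free and measure preserving $\mathbb Z^d$ action $T$ of a Lebesgue probability space $(X,\mathcal M,\mu)$, for all $j\ge 1$ there are Rohlin towers $\tau^j\subset X$ of shape $R_{\vec w^j}$ such that $\mu(\tau^j)=p_j$ for all $j\ge 1$, $\tau^j\cap\tau^{j'}=\emptyset$ whenever $j\ne j'$, and $\bigcup_{j=1}^\infty\tau^j=X$ up to a $\mu$-null set.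
   Context: $\mathbb N=\{1,2,\ldots\}$. For $\vec w=(w_1,\ldots,w_d)\in\mathbb N^d$, $R_{\vec w}=\prod_{i=1}^d\{0,1,\ldots,w_i-1\}\subset\mathbb Z^d$. A Lebesgue probability space is a standard non-atomic probability space. A measure preserving $\mathbb Z^d$ action $T=\{T^{\vec v}\}_{\vec v\in\mathbb Z^d}$ is free if for $\mu$-a.e. $x$ one has $T^{\vec v}x\neq x$ for all $\vec v\ne\vec 0$. A set $\tau\subset X$ is a Rohlin tower of shape $R_{\vec w}$ if there is a set $F\in\mathcal M$ (the base of the tower) such that $\tau=\bigcup_{\vec v\in R_{\vec w}}T^{\vec v}F$ and $T^{\vec v}F\cap T^{\vec u}F=\emptyset$ for all distinct $\vec v,\vec u\in R_{\vec w}$. The action is not assumed ergodic. *)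

(* Defs.v *)
From mathcomp Require Import all_boot all_order all_algebra.
From mathcomp Require Import all_classical all_reals all_analysis.

Set Implicit Arguments.
Unset Strict Implicit.
Unset Printing Implicit Defensive.
Import Order.TTheory GRing.Theory Num.Theory.
Local Open Scope classical_set_scope.
Local Open Scope ring_scope.

(* [g] is the gcd of the whole (infinite) sequence [a]. *)
Definition is_gcd_seq (a : nat -> nat) (g : nat) : Prop :=
  (forall j, (g %| a j)%N) /\
  (forall k, (forall j, (k %| a j)%N) -> (k %| g)%N).

Definition separable (T : topologicalType) : Prop :=
  exists2 D : set T, countable D & dense D.

Definition conull {R : realType} {d : measure_display} {X : measurableType d}
    (mu : probability X R) (A : set X) : Prop :=
  measurable A /\ mu (~` A) = 0%E.

(* Isomorphism modulo null sets: a bijection between conull sets that preserves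
   measurability and measure in both directions. Sets are compared up to null
   sets, so that a space and its completion are isomorphic; this covers both
   conventions for standard spaces (complete or not). *)
Definition isomorphic_mod0 {R : realType} {d d' : measure_display}
    {X : measurableType d} {Y : measurableType d'}
    (mu : probability X R) (nu : probability Y R) : Prop :=
  exists (f : X -> Y) (X0 : set X) (Y0 : set Y),
    [/\ conull mu X0, conull nu Y0, set_bij X0 Y0 f,
        (forall B, measurable B -> exists A, [/\ measurable A,
           mu.-negligible ((X0 `&` f @^-1` B) `+` A) & mu A = nu B]) &
        (forall A, measurable A -> exists B, [/\ measurable B,
           nu.-negligible ((f @` (X0 `&` A)) `+` B) & nu B = mu A])].

(* Up to null sets, a Borel probability measure on a Polish space [P]; the
   Hausdorff condition makes the pseudometric of [P] a metric. *)
Definition standard_probability {R : realType} {d : measure_display}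
    {X : measurableType d} (mu : probability X R) : Prop :=
  exists P : completePseudoMetricType R,
    [/\ hausdorff_space P, separable P &
        exists nu : probability (g_sigma_algebraType (@open P)) R,
          isomorphic_mod0 mu nu].

Definition nonatomic {R : realType} {d : measure_display}
    {X : measurableType d} (mu : probability X R) : Prop :=
  forall A, measurable A -> (0 < mu A)%E ->
    exists B, [/\ measurable B, B `<=` A, (0 < mu B)%E & (mu B < mu A)%E].

Definition lebesgue_probability {R : realType} {d : measure_display}
    {X : measurableType d} (mu : probability X R) : Prop :=
  standard_probability mu /\ nonatomic mu.

Definition Zd_action {n : nat} {X : Type} (T : 'rV[int]_n -> X -> X) : Prop :=
  (forall x, T 0 x = x) /\ (forall u v x, T (u + v) x = T u (T v x)).

Definition measure_preserving_action {R : realType} {d : measure_display}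
    {X : measurableType d} (mu : probability X R)
    {n : nat} (T : 'rV[int]_n -> X -> X) : Prop :=
  [/\ Zd_action T, (forall v, measurable_fun setT (T v)) &
      (forall v A, measurable A -> mu (T v @^-1` A) = mu A)].

Definition free_action {R : realType} {d : measure_display}
    {X : measurableType d} (mu : probability X R)
    {n : nat} (T : 'rV[int]_n -> X -> X) : Prop :=
  {ae mu, forall x, forall v, v <> 0 -> T v x <> x}.

Definition box {n : nat} (w : 'rV[nat]_n) : set 'rV[int]_n :=
  [set v | forall i, (0 <= v 0 i) /\ (v 0 i < (w 0 i)%:Z)].

Definition rohlin_tower {d : measure_display} {X : measurableType d} {n : nat}
    (T : 'rV[int]_n -> X -> X) (w : 'rV[nat]_n) (tau : set X) : Prop :=
  exists F : set X,
    [/\ measurable F,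
        tau = \bigcup_(v in box w) (T v @` F) &
        (forall u v, box w u -> box w v -> u <> v ->
           (T u @` F) `&` (T v @` F) = set0)].

(* Main.v *)
(* Since the sides w^0_i, w^1_i, ... have gcd 1, finitely many types
   j < k generate every integer >= M as a sum of i-th sides.  Hence a box is tiled
   by types j < k as soon as one side is >= M and the other sides are multiples of
   all the sides of these types.  Therefore a cube placed anywhere relative to
   a grid of step S can be extended, one coordinate at a time and by thin slabs
   tiled by types j < k, to a box of that grid, and the complement of such boxes
   in a large cube of the grid is a union of cubes of side S.

   Take Rohlin towers of cubes whose sides grow so fast that almost every point
   lies deep inside the cubes of all late towers.  Keeping only the cubes that lie
   in a kept cube of the next tower gives increasing sets W_m that exhaust the
   space, and W_(m+1) \ W_m splits into thin slabs, of total measure less than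
   each p_j with j < k, and cubes of side S_(m+1).  Each cube can be cut into
   boxes of any single type whose sides divide S_(m+1), so the cubes are
   distributed among the types so as to reach the measures p_j exactly.
   The measure outside W_m is bounded below by a number fixed in advance, and
   S_m is a multiple of the sides of all types but a tail whose total p_j is
   smaller than that number: those types are served by later cubes. *)
Require Import Defs.
From mathcomp Require Import all_boot all_order all_algebra.
From mathcomp Require Import all_classical all_reals all_analysis.
From mathcomp Require Import zify ring lra.
Set Implicit Arguments.
Unset Strict Implicit.
Unset Printing Implicit Defensive.
Import Order.TTheory GRing.Theory Num.Theory.
Import numFieldNormedType.Exports.
Local Open Scope classical_set_scope.
Local Open Scope ring_scope.

(** * Cubes, probabilities and towers *)

Definition cube {n : nat} (a b : int) : set 'rV[int]_n :=
  [set v | forall i, a <= v 0 i < b].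

(* Unlike [mxE], these keep [int] as the type of the entries, which [lia] needs. *)
Lemma zrowD n (u v : 'rV[int]_n) i : (u + v) 0 i = u 0 i + v 0 i.
Proof. by rewrite mxE. Qed.

Lemma zrowN n (u : 'rV[int]_n) i : (- u) 0 i = - u 0 i.
Proof. by rewrite mxE. Qed.

Lemma zrow0E n i : (0 : 'rV[int]_n) 0 i = 0.
Proof. by rewrite mxE. Qed.

Lemma zrowZ n (k : int) (u : 'rV[int]_n) i : (k *: u) 0 i = k * u 0 i.
Proof. by rewrite mxE. Qed.

Lemma zrowF n (f : 'I_n -> int) i : (\row_j f j) 0 i = f i.
Proof. by rewrite mxE. Qed.

Definition zrowE := (zrowD, zrowN, zrow0E, zrowZ, zrowF).

Lemma cube_sub n (a b a' b' : int) :
  a' <= a -> b <= b' -> cube a b `<=` @cube n a' b'.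
Proof. by move=> ha hb v hv i; have := hv i; lia. Qed.

(** A duplicate-free list of the points of the cube, so that the measure of a tower is computed by
    induction over its levels. *)
Definition cube_seq (n : nat) (a : int) (m : nat) : seq 'rV[int]_n :=
  [seq \row_i (a + (g 0 i : nat)%:Z) | g : 'rV['I_m]_n].

Lemma size_cube_seq n a m : size (cube_seq n a m) = (m ^ n)%N.
Proof. by rewrite size_map -cardE card_mx card_ord mul1n. Qed.

Lemma uniq_cube_seq n a m : uniq (cube_seq n a m).
Proof.
rewrite map_inj_uniq ?enum_uniq // => g h /rowP gh; apply/rowP => i.
by have := gh i; rewrite !mxE => /addrI[] /val_inj.
Qed.

Lemma mem_cube_seq n a m (v : 'rV[int]_n) :
  reflect (cube a (a + m%:Z) v) (v \in cube_seq n a m).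
Proof.
apply: (iffP idP) => [/mapP[g _ ->] i|hv].
  by rewrite mxE; have := ltn_ord (g 0 i); move: (nat_of_ord _) => q; lia.
have hlt i : (`|(v 0%R i - a)%R| < m)%N by have := hv i; lia.
apply/mapP; exists (\row_i Ordinal (hlt i)); first by rewrite mem_enum.
by apply/rowP => i; rewrite !mxE /=; have := hv i; lia.
Qed.

Definition shell_seq (n : nat) (a : int) (k m : nat) : seq 'rV[int]_n :=
  [seq v <- cube_seq n a (k + m + k) | v \notin cube_seq n (a + k%:Z) m].

Lemma mem_shell_seq n a k m (v : 'rV[int]_n) :
  v \in shell_seq n a k m <->
  cube a (a + (k + m + k)%N%:Z) v /\ ~ cube (a + k%:Z) (a + k%:Z + m%:Z) v.
Proof.
rewrite mem_filter; split => [/andP[/mem_cube_seq h /mem_cube_seq]//|[h1 h2]].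
by apply/andP; split; apply/mem_cube_seq.
Qed.

Lemma size_shell_seq n a k m :
  size (shell_seq n a k m) = ((k + m + k) ^ n - m ^ n)%N.
Proof.
have := count_predC (mem (cube_seq n (a + k%:Z) m)) (cube_seq n a (k + m + k)).
rewrite size_cube_seq size_filter => <-.
suff -> : count (mem (cube_seq n (a + k%:Z) m)) (cube_seq n a (k + m + k)) =
  (m ^ n)%N by rewrite addKn.
rewrite -(size_cube_seq n (a + k%:Z) m) -size_filter; apply/perm_size.
apply: uniq_perm; rewrite ?filter_uniq ?uniq_cube_seq // => v.
rewrite mem_filter /=; apply: andb_idr => /mem_cube_seq hv.
by apply/mem_cube_seq; apply: cube_sub hv; lia.
Qed.

(** Discrete mean value inequality, from b^(n+1) - a^(n+1) = (b - a) a^n + b (b^n - a^n). It bounds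
    the number of points in a layer near the boundary of a cube. *)
Lemma expnB_le n (a b : nat) : (a <= b)%N ->
  (b ^ n - a ^ n <= n * (b - a) * b ^ n.-1)%N.
Proof.
move=> ab; elim: n => [|n IH]; first by rewrite !expn0.
have h1 : (a ^ n <= b ^ n)%N by case: n {IH} => // n; rewrite leq_exp2r.
rewrite /= !expnS.
have -> : (b * b ^ n - a * a ^ n = (b - a) * a ^ n + b * (b ^ n - a ^ n))%N.
  rewrite mulnBl mulnBr.
  have h2 : (a * a ^ n <= b * a ^ n)%N by rewrite leq_mul2r ab orbT.
  have h3 : (b * a ^ n <= b * b ^ n)%N by rewrite leq_mul2l h1 orbT.
  lia.
have h4 : (b * (n * (b - a) * b ^ n.-1) = n * (b - a) * b ^ n)%N.
  by case: n {IH h1} => [|n]; rewrite ?mul0n ?muln0//= expnS; ring.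
have h5 := leq_mul (leqnn b) IH; rewrite h4 in h5.
have h6 : ((b - a) * a ^ n <= (b - a) * b ^ n)%N by rewrite leq_mul2l h1 orbT.
have -> : (n.+1 * (b - a) * b ^ n = (b - a) * b ^ n + n * (b - a) * b ^ n)%N by ring.
exact: leq_add.
Qed.

Lemma measurable_bigcup_count {d} {X : measurableType d} (I : countType)
    (D : set I) (F : I -> set X) :
  (forall i, D i -> measurable (F i)) -> measurable (\bigcup_(i in D) F i).
Proof.
move=> mF; rewrite bigcup_mkcond.
apply: countable_bigcupT_measurable => [|i]; first exact: countableP.
by case: ifPn => // /set_mem /mF.
Qed.

(** * Measures as real numbers *)

Section RealValuedProbability.
Context {R : realType} {d : measure_display} {X : measurableType d}.
Variable mu : probability X R.
Implicit Types A B : set X.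

Definition pr A : R := fine (mu A).

Lemma prE A : measurable A -> mu A = (pr A)%:E.
Proof. by move=> mA; rewrite /pr fineK // fin_num_measure. Qed.

Lemma pr_ge0 A : 0 <= pr A.
Proof. exact: fine_ge0. Qed.

Lemma pr_le A B : measurable A -> measurable B -> A `<=` B -> pr A <= pr B.
Proof.
move=> mA mB AB; rewrite -lee_fin -!prE //.
by apply: le_measure => //; rewrite inE.
Qed.

Lemma pr0 : pr set0 = 0.
Proof. by rewrite /pr measure0. Qed.

Lemma prT : pr setT = 1.
Proof. by rewrite /pr probability_setT. Qed.

Lemma pr_le1 A : measurable A -> pr A <= 1.
Proof. by move=> mA; rewrite -prT; exact: pr_le. Qed.

Lemma prU_le A B : measurable A -> measurable B -> pr (A `|` B) <= pr A + pr B.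
Proof.
move=> mA mB; have mAB := measurableU _ _ mA mB.
rewrite -lee_fin EFinD -(prE mA) -(prE mB) -(prE mAB); exact: measureU2.
Qed.

Lemma prU A B : measurable A -> measurable B -> A `&` B = set0 ->
  pr (A `|` B) = pr A + pr B.
Proof.
move=> mA mB AB; have mAB := measurableU _ _ mA mB; apply: EFin_inj.
rewrite EFinD -(prE mA) -(prE mB) -(prE mAB); exact: measureU.
Qed.

Lemma prD A B : measurable A -> measurable B -> B `<=` A ->
  pr (A `\` B) = pr A - pr B.
Proof.
move=> mA mB BA; rewrite -{2}(setDUK BA) prU ?setDIK //; first by ring.
exact: measurableD.
Qed.

Lemma prC A : measurable A -> pr (~` A) = 1 - pr A.
Proof. by move=> mA; rewrite -setTD prD // prT. Qed.

Lemma cvg_pr_bigcup (F : nat -> set X) : (forall i, measurable (F i)) ->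
  trivIset setT F ->
  (fun N => \sum_(0 <= i < N) pr (F i)) @ \oo --> pr (\bigcup_i F i).
Proof.
move=> mF tF; have mU : measurable (\bigcup_i F i) by exact: bigcup_measurable.
have h : (fun N => \sum_(0 <= i < N) mu (F i))%E @ \oo --> mu (\bigcup_i F i).
  exact: measure_semi_sigma_additive.
move: h; rewrite (prE mU) => /fine_cvg; apply: cvg_trans.
apply: near_eq_cvg; near=> N; rewrite /=.
under eq_bigr do rewrite prE //.
by rewrite sumEFin.
Unshelve. all: by end_near. Qed.

Lemma pr_bigcup_le (F : nat -> set X) (c : R) : (forall i, measurable (F i)) ->
  (forall N, \sum_(0 <= i < N) pr (F i) <= c) -> pr (\bigcup_i F i) <= c.
Proof.
move=> mF h; have mU : measurable (\bigcup_i F i) by exact: bigcup_measurable.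
rewrite -lee_fin -prE //.
have h2 : (mu (\bigcup_i F i) <= \sum_(0 <= i <oo) mu (F i))%E.
  exact: generalized_Boole_inequality.
apply: le_trans h2 _; apply: lime_le; first by apply: is_cvg_nneseries.
near=> N; under eq_bigr do rewrite prE //.
by rewrite sumEFin lee_fin.
Unshelve. all: by end_near. Qed.

End RealValuedProbability.

(** * Towers of arbitrary shape and their measure *)

Section Towers.
Context {R : realType} {n : nat} {d : measure_display} {X : measurableType d}.
Variables (mu : probability X R) (T : 'rV[int]_n -> X -> X).
Hypothesis hT : measure_preserving_action mu T.
Local Notation V := 'rV[int]_n.

(** The union of the images of [F] under [T v], [v] in [A], written with preimages under the inverse
    maps so that measurability is immediate. *)
Definition tower (A : set V) (F : set X) : set X :=
  [set x | exists2 v, A v & F (T (- v) x)].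

Definition disjoint_tower (A : set V) (F : set X) : Prop :=
  forall u v x, A u -> A v -> F (T (- u) x) -> F (T (- v) x) -> u = v.

Lemma act0 x : T 0 x = x.
Proof. by case: hT => -[]. Qed.

Lemma actA u v x : T u (T v x) = T (u + v) x.
Proof. by case: hT => -[_ ->]. Qed.

Lemma actBK u v x : T (- (u - v)) (T (- v) x) = T (- u) x.
Proof. by rewrite actA opprB addrAC subrr add0r. Qed.

Lemma measurable_act v F : measurable F -> measurable [set x | F (T v x)].
Proof.
by move=> mF; case: hT => _ /(_ v) mT _; have := mT measurableT F mF; rewrite setTI.
Qed.

Lemma pr_act v F : measurable F -> pr mu [set x | F (T v x)] = pr mu F.
Proof. by move=> mF; case: hT => _ _ /(_ v F mF); rewrite /pr => <-. Qed.

Lemma measurable_tower A F : measurable F -> measurable (tower A F).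
Proof.
move=> mF.
have -> : tower A F = \bigcup_(v in A) [set x | F (T (- v) x)] by [].
by apply: measurable_bigcup_count => v _; apply: measurable_act.
Qed.

Lemma tower_sub A B F G : A `<=` B -> F `<=` G -> tower A F `<=` tower B G.
Proof. by move=> AB FG x [v /AB Bv /FG Gv]; exists v. Qed.

Lemma disjoint_tower_sub A B F G : A `<=` B -> F `<=` G ->
  disjoint_tower B G -> disjoint_tower A F.
Proof.
move=> AB FG h u v x Au Av Fu Fv.
by apply: (h u v x); [exact: AB|exact: AB|exact: FG|exact: FG].
Qed.

Lemma tower_cons v s F : tower [set` v :: s] F =
  [set x | F (T (- v) x)] `|` tower [set` s] F.
Proof.
apply/seteqP; split => [x [u /=]|x [Fx|[u /= us Fu]]].
- by rewrite inE => /orP[/eqP->|us] Fu; [left|right; exists u].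
- by exists v => //=; rewrite inE eqxx.
- by exists u => //=; rewrite inE us orbT.
Qed.

Lemma pr_tower_le (s : seq V) F : measurable F ->
  pr mu (tower [set` s] F) <= (size s)%:R * pr mu F.
Proof.
move=> mF; elim: s => [|v s IH].
  have -> : tower [set` [::]] F = set0 by rewrite -subset0 => x [].
  by rewrite pr0 mul0r.
rewrite tower_cons; apply: le_trans (prU_le _ _ _) _.
- exact: measurable_act.
- exact: measurable_tower.
by rewrite pr_act //= -natr1 mulrDl mul1r addrC lerD2r.
Qed.

Lemma pr_tower (s : seq V) F : measurable F -> uniq s ->
  disjoint_tower [set` s] F ->
  pr mu (tower [set` s] F) = (size s)%:R * pr mu F.
Proof.
move=> mF; elim: s => [|v s IH].
  have -> : tower [set` [::]] F = set0 by rewrite -subset0 => x [].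
  by rewrite pr0 mul0r.
move=> /= /andP[vs us] dis; rewrite tower_cons prU.
- rewrite pr_act // IH //; first by rewrite -natr1 mulrDl mul1r addrC.
  by apply: disjoint_tower_sub dis => // u /= us'; rewrite inE us' orbT.
- exact: measurable_act.
- exact: measurable_tower.
- rewrite -subset0 => x [Fv [u /= us' Fu]].
  have uv : u = v by apply: (dis u v x) => //=; rewrite inE ?eqxx ?us' ?orbT.
  by rewrite -uv us' in vs.
Qed.

Lemma cube_seqE a m : [set` cube_seq n a m] = cube a (a + m%:Z).
Proof. by apply/seteqP; split => v /mem_cube_seq. Qed.

Lemma pr_cube_tower a (m : nat) F : measurable F ->
  disjoint_tower (cube a (a + m%:Z)) F ->
  pr mu (tower (cube a (a + m%:Z)) F) = (m ^ n)%:R * pr mu F.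
Proof.
move=> mF; rewrite -cube_seqE => dis.
by rewrite pr_tower ?uniq_cube_seq // size_cube_seq.
Qed.

End Towers.

(** * Separated covers *)

Section NullSets.
Context {R : realType} {d : measure_display} {X : measurableType d}.
Variable mu : probability X R.

Definition null (N : set X) := measurable N /\ pr mu N = 0.

Lemma negligible_null A : mu.-negligible A -> exists2 N, null N & A `<=` N.
Proof. by case=> N [mN N0 AN]; exists N => //; split=> //; rewrite /pr N0. Qed.

Lemma nullU A B : null A -> null B -> null (A `|` B).
Proof.
move=> [mA A0] [mB B0]; split; first exact: measurableU.
by apply/eqP; rewrite eq_le pr_ge0 andbT (le_trans (prU_le _ _ _)) // A0 B0 addr0.
Qed.

Lemma null_bigcup (I : countType) (F : I -> set X) :
  (forall i, null (F i)) -> null (\bigcup_i F i).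
Proof.
move=> nF; pose G m := oapp F set0 (unpickle m).
have nG m : null (G m).
  by rewrite /G; case: unpickle => [i|] //=; split; rewrite ?pr0.
have -> : \bigcup_i F i = \bigcup_m G m.
  apply/seteqP; split=> [x [i _ Fx]|x [m _]].
    by exists (pickle i) => //; rewrite /G pickleK.
  by rewrite /G; case: unpickle => [i|] //= Fx; exists i.
split; first by apply: bigcup_measurable => m _; case: (nG m).
apply/eqP; rewrite eq_le pr_ge0 andbT; apply: pr_bigcup_le => [m|N].
  by case: (nG m).
by rewrite big1 // => m _; case: (nG m).
Qed.

(** Balls with centres in a countable dense set and radii 1/(k+1) separate the points of [P]. Their
    preimages agree with measurable sets up to null sets, and the countably many exceptional sets
    are collected in [N]. *)
Lemma separating_family : standard_probability mu ->
  exists (E : nat * nat -> set X) (N : set X), [/\ forall i, measurable (E i),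
    null N & forall x y, ~ N x -> ~ N y -> x <> y -> exists2 i, E i x & ~ E i y].
Proof.
move=> [P [hP [D cD dD] [nu [f [X0 [Y0 [[mX0 X00] _ [_ injf _] pre _]]]]]]].
have /countable_injP[g injg] := cD.
(* The index is the code [g p] of the centre together with the radius; interiors are taken because
   balls need not be open. *)
pose B (i : nat * nat) : set P :=
  \bigcup_(p in [set p | D p /\ g p = i.1]) interior (ball p (i.2.+1%:R^-1 : R)).
have mB i : measurable (B i : set (g_sigma_algebraType (@open P))).
  by apply: sub_sigma_algebra; apply: bigcup_open => p _; exact: open_interior.
have /choice[A hA] : forall i, exists A, measurable A /\
    exists2 N, null N & ((X0 `&` f @^-1` B i) `+` A) `<=` N.
  by move=> i; have [A [mA /negligible_null nA _]] := pre _ (mB i); exists A.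
have /choice[M hM] : forall i, exists M, null M /\
    ((X0 `&` f @^-1` B i) `+` A i) `<=` M.
  by move=> i; have [_ [M nM sM]] := hA i; exists M.
have AB i x : X0 x -> ~ M i x -> (A i x <-> B i (f x)).
  move=> X0x nMx; split=> [Ax|Bx]; apply: contrapT => h; apply: nMx;
    apply: (hM i).2; [right|left]; split=> //.
    by case=> _.
exists A, (~` X0 `|` \bigcup_i M i); split.
- by move=> i; case: (hA i).
- apply: nullU; last by apply: null_bigcup => i; case: (hM i).
  by split; [exact: measurableC|rewrite /pr X00].
move=> x y; rewrite /setU /= => /not_orP[/contrapT X0x Mx] /not_orP[/contrapT X0y My] xy.
have nfxy : f x <> f y by move=> h; apply: xy; apply: injf h; rewrite inE.
have [e e0 hxy] : exists2 e : R, 0 < e & ~ ball (f x) e (f y).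
  apply: contrapT => /forall2NP h; apply: nfxy; apply: hP => U V.
  move=> /nbhs_ballP[e e0 Ue] /nbhs_ballP[e' e'0 Ve'].
  exists (f y); split; last exact/Ve'/ballxx.
  by apply: Ue; case: (h e) => [|/contrapT].
have [k hk] : exists k : nat, (k.+1%:R^-1 : R) < e / 2.
  have := @near_infty_natSinv_lt R (PosNum (divr_gt0 e0 (ltr0Sn R 1))).
  by case=> k _ /(_ k (leqnn k)) h; exists k.
set r := (k.+1%:R^-1 : R) in hk.
have r0 : 0 < r by rewrite invr_gt0.
(* A centre within r/2 of [f x]: its r-ball contains a neighbourhood of [f x], and if it contained
   [f y] the distance would be below r/2 + r < e. *)
have [p [/interior_subset bp Dp]] : interior (ball (f x) (r / 2)) `&` D !=set0.
  apply: dD; last exact: open_interior.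
  by exists (f x); apply: nbhsx_ballx; rewrite divr_gt0.
have Bx : B (g p, k) (f x).
  exists p => //; apply/nbhs_ballP; exists (r / 2); first by rewrite /= divr_gt0.
  move=> z bz; rewrite -/r [r]splitr; apply: ball_triangle bz.
  by apply: ball_sym.
exists (g p, k).
  by apply/AB => // Mi; apply: Mx; exists (g p, k).
move/AB => /(_ X0y); case=> [Mi|q /= [Dq gq] /interior_subset bq].
  by apply: My; exists (g p, k).
have qp : q = p by apply: injg; rewrite ?inE.
rewrite {}qp in bq; apply: hxy.
apply: (@le_ball _ _ _ (r / 2 + r)); first by move: hk r0; lra.
exact: ball_triangle bp bq.
Qed.

End NullSets.

Section Markers.
Context {R : realType} {n : nat} {d : measure_display} {X : measurableType d}.
Variables (mu : probability X R) (T : 'rV[int]_n -> X -> X).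
Hypothesis hT : measure_preserving_action mu T.
Hypothesis hmu : standard_probability mu.
Hypothesis hfree : free_action mu T.
Local Notation V := 'rV[int]_n.

Lemma separated_cover (P : int) : exists A : nat -> set X,
  [/\ forall k, measurable (A k), null mu (~` \bigcup_k A k) &
      forall k v x, cube (- P) (P + 1) v -> A k x -> A k (T v x) -> v = 0].
(* By freeness almost every x differs from [T v x], so some [E i] contains x but not [T v x]. The
   set of all such x is disjoint from its translate by v. The cover is refined in this way for each
   of the finitely many v. *)
Proof.
have [E [N [mE nN sepE]]] := separating_family hmu.
have [N1 nN1 freeN1] := negligible_null hfree.
(* The exceptional points of the whole orbit are discarded, so that separation applies to x and
   [T v x] alike. *)
pose Bad := N1 `|` \bigcup_(v : V) [set x | N (T v x)].
have nBad : null mu Bad.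
  apply: nullU => //; apply: null_bigcup => v.
  have [mN N0] := nN; split; first exact: (measurable_act hT).
  by rewrite (pr_act hT).
have key (s : seq V) : exists A : nat -> set X,
  [/\ forall k, measurable (A k), forall x, ~ Bad x -> exists k, A k x &
      forall k v x, v \in s -> A k x -> A k (T v x) -> v = 0].
  elim: s => [|v s [A [mA cA sA]]].
    by exists (fun=> setT); split=> // x _; exists 0%N.
  have [->|v0] := eqVneq v 0.
    exists A; split=> // k u x; rewrite inE => /orP[/eqP //|]; exact: sA.
  pose A' m := if unpickle m is Some (k, i) then
    A k `&` (E i `&` [set x | ~ E i (T v x)]) else set0.
  exists A'; split.
  - move=> m; rewrite /A'; case: unpickle => [[k i]|] //.
    apply: measurableI => //; apply: measurableI => //.
    by apply: (measurable_act hT v (F := ~` E i)); exact: measurableC.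
  - move=> x Bx; have [k Ax] := cA _ Bx.
    have [||/esym|i Ei nEi] := @sepE x (T v x).
    + by move=> Nx; apply: Bx; right; exists 0 => //=; rewrite (act0 hT).
    + by move=> Nx; apply: Bx; right; exists v.
    + move=> h; apply: Bx; left; apply: freeN1 => /= /(_ v); apply => //.
      exact/eqP.
    by exists (pickle (k, i)); rewrite /A' pickleK.
  - move=> m u x; rewrite /A'; case: unpickle => [[k i]|] //.
    rewrite inE => /orP[/eqP-> [_ [_ nE]] [_ [Ei _]] //|us [Ax _] [Ax' _]].
    exact: sA us Ax Ax'.
have [A [mA cA sA]] := key (cube_seq n (- P) `|(P + 1 + P)%R|%N).
exists A; split => //.
- have mU : measurable (~` \bigcup_k A k) by apply: measurableC; exact: bigcup_measurable.
  split=> //; apply/eqP; rewrite eq_le pr_ge0 andbT -nBad.2; apply: pr_le => //.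
    by case: nBad.
  by move=> x nx; apply: contrapT => /cA[k Ak]; apply: nx; exists k.
- move=> k v x cv; apply: sA; apply/mem_cube_seq => i; have := cv i; lia.
Qed.

End Markers.

(** * Subsets of prescribed measure *)

Section Nonatomic.
Context {R : realType} {d : measure_display} {X : measurableType d}.
Variable mu : probability X R.
Hypothesis hna : nonatomic mu.
Local Notation pr := (pr mu).

Lemma nonatomic_half A : measurable A -> 0 < pr A ->
  exists B, [/\ measurable B, B `<=` A, 0 < pr B & pr B <= pr A / 2].
Proof.
move=> mA A0; have [|B [mB BA B0 BltA]] := hna mA.
  by rewrite prE // lte_fin.
rewrite !prE // !lte_fin in B0 BltA.
have [h|h] := leP (pr B) (pr A / 2); first by exists B.
have mAB : measurable (A `\` B) by exact: measurableD.
have e := prD mu mA mB BA.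
by exists (A `\` B); split=> //; rewrite e; lra.
Qed.

(** Repeated halving; the bound 1/(k+1) is weaker than the geometric one but is preserved by a
    halving and tends to 0. *)
Lemma nonatomic_small A e : measurable A -> 0 < pr A -> 0 < e ->
  exists B, [/\ measurable B, B `<=` A, 0 < pr B & pr B < e].
Proof.
move=> mA A0 e0.
have key k : exists B, [/\ measurable B, B `<=` A, 0 < pr B & pr B <= k.+1%:R^-1].
  elim: k => [|k [B [mB BA B0 Bk]]].
    by exists A; split=> //; rewrite invr1; exact: pr_le1.
  have [C [mC CB C0 Ck]] := nonatomic_half mB B0.
  exists C; split=> //; first exact: subset_trans BA.
  apply: (le_trans Ck); apply: (@le_trans _ _ (k.+1%:R^-1 / 2)).
    by rewrite ler_pM2r // invr_gt0.
  by rewrite -invfM -natrM lef_pV2 ?posrE // ler_nat; lia.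
have [k _ /(_ k (leqnn k)) hk] := @near_infty_natSinv_lt R (PosNum e0).
by have [B [mB BA B0 Bk]] := key k; exists B; split=> //; exact: le_lt_trans hk.
Qed.

(** Sierpinski's theorem by greedy exhaustion: each stage adds a set of at least half the largest
    measure still allowed. If the union fell short of t, one fixed set of positive measure would
    remain allowed at all stages, and the total would be infinite. *)
Lemma nonatomic_subset G t : measurable G -> 0 <= t <= pr G ->
  exists B, [/\ measurable B, B `<=` G & pr B = t].
Proof.
move=> mG /andP[t0 tG].
pose ok U C := [/\ measurable C, C `<=` G `\` U & pr U + pr C <= t].
have /choice[next hnext] : forall U, exists C, measurable U -> pr U <= t ->
    ok U C /\ forall C', ok U C' -> pr C' <= 2 * pr C.
  move=> U; have [[mU Ut]|h] := pselect (measurable U /\ pr U <= t); last first.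
    by exists set0 => mU Ut; case: h.
  pose S := [set pr C | C in ok U].
  have ok0 : ok U set0 by split=> //; rewrite pr0 addr0.
  have supS : has_sup S.
    split; first by exists (pr set0); exists set0.
    by exists 1 => _ [C [mC _ _] <-]; exact: pr_le1.
  (* If only null sets can be added, the empty set is already optimal. *)
  have [s0|s0] := leP (sup S) 0.
    exists set0 => _ _; split=> // C' okC'; rewrite pr0 mulr0.
    by apply: le_trans s0; apply: ub_le_sup => //; [case: supS|exists C'].
  have [|_ [C okC <-] hC] := @sup_adherent _ S (sup S / 2) _ supS.
    by rewrite divr_gt0.
  exists C => _ _; split=> // C' okC'.
  have : pr C' <= sup S by apply: ub_le_sup => //; [case: supS|exists C'].
  by move: hC; lra.
pose U := fix U k := if k is k.+1 then U k `|` next (U k) else set0.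
have hU k : measurable (U k) /\ pr (U k) <= t.
  elim: k => [|k [mU Ut]]; first by rewrite /= pr0; split.
  have [[mC CG Ct] _] := hnext _ mU Ut.
  split; first exact: measurableU.
  exact: le_trans (prU_le _ mU mC) Ct.
pose C k := next (U k).
have okC k : ok (U k) (C k) by have [a b] := hU k; have [] := hnext _ a b.
have mC k : measurable (C k) by case: (okC k).
have prUS N : pr (U N) = \sum_(0 <= i < N) pr (C i).
  elim: N => [|N IH]; first by rewrite big_geq //= pr0.
  rewrite big_nat_recr //= -IH; apply: prU; [by case: (hU N)|exact: mC|].
  by rewrite -subset0 => x [Ux Cx]; case: (okC N) => _ /(_ _ Cx) [].
have UC N : U N `<=` \bigcup_k C k.
  by elim: N => //= N IH x [/IH //|Cx]; exists N.
pose B := \bigcup_k C k.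
have mB : measurable B by exact: bigcup_measurable.
have BG : B `<=` G by move=> x [k _]; case: (okC k) => _ h _ /h [].
have Bt : pr B <= t by apply: pr_bigcup_le => // N; rewrite -prUS; case: (hU N).
exists B; split=> //; apply/eqP; rewrite eq_le Bt leNgt; apply/negP => Blt.
have [|||C' [mC' C'GB C'0 C't]] := @nonatomic_small (G `\` B) (t - pr B).
- exact: measurableD.
- by rewrite prD //; lra.
- by lra.
(* [C'] avoids the whole union and fits under the bound t, hence is a candidate at every stage. *)
have okC' k : ok (U k) C'.
  split=> //; first by move=> x /C'GB [Gx nBx]; split=> // /UC.
  have : pr (U k) <= pr B by apply: pr_le => //; case: (hU k).
  by lra.
have C'C k : pr C' / 2 <= pr (C k).
  have [a b] := hU k; have [_ /(_ _ (okC' k))] := hnext _ a b.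
  by rewrite -/(C k); lra.
have N_le N : N%:R * (pr C' / 2) <= t.
  have [_] := hU N; apply: le_trans; rewrite prUS mulr_natl.
  have -> : pr C' / 2 *+ N = \sum_(0 <= i < N) (pr C' / 2).
    by rewrite sumr_const_nat subn0.
  exact: ler_sum.
have C'20 : 0 < pr C' / 2 by rewrite divr_gt0.
have := N_le (Num.bound (t / (pr C' / 2))).
rewrite leNgt -ltr_pdivrMr //.
by move/negP; apply; apply: archi_boundP; rewrite divr_ge0 // ltW.
Qed.

(** Disjoint pieces are cut off one after another. A prescribed measure 0 yields the empty set and
    not just a null set, so that a type with no share is really absent from the later tilings. *)
Lemma nonatomic_split G (t : nat -> R) : measurable G -> (forall j, 0 <= t j) ->
  (forall N, \sum_(0 <= j < N) t j <= pr G) ->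
  exists B : nat -> set X, [/\ forall j, measurable (B j), forall j, B j `<=` G,
    forall j, pr (B j) = t j, forall j, t j = 0 -> B j = set0 & trivIset setT B].
Proof.
move=> mG t0 tG.
have /choice[next hnext] : forall Ur : set X * R, exists C,
    measurable Ur.1 -> 0 <= Ur.2 <= pr (G `\` Ur.1) ->
    [/\ measurable C, C `<=` G `\` Ur.1, pr C = Ur.2 & Ur.2 = 0 -> C = set0].
  move=> [U r] /=; have [->|/eqP r0] := eqVneq r 0.
    by exists set0; rewrite pr0.
  have [mU|mU] := pselect (measurable U); last by exists set0.
  have [h|h] := boolP (0 <= r <= pr (G `\` U)); last by exists set0.
  by have [C [mC CG Cr]] := nonatomic_subset (measurableD mG mU) h; exists C.
pose U := fix U k := if k is k.+1 then U k `|` next (U k, t k) else set0.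
have hU k : [/\ measurable (U k), U k `<=` G & pr (U k) = \sum_(0 <= j < k) t j].
  elim: k => [|k [mU UG Ut]]; first by rewrite big_geq //= pr0; split.
  have [] := hnext (U k, t k) mU.
    by rewrite t0 /= prD // Ut; have := tG k.+1; rewrite big_nat_recr //=; lra.
  move=> mC CG Ck _; split; first exact: measurableU.
    by move=> x [/UG //|/CG []].
  rewrite big_nat_recr //= -Ut prU // ?Ck // -subset0 => x [Ux /CG []]//.
have hB k : [/\ measurable (next (U k, t k)), next (U k, t k) `<=` G `\` U k,
    pr (next (U k, t k)) = t k & t k = 0 -> next (U k, t k) = set0].
  have [mU UG Ut] := hU k; apply: hnext => //=.
  by rewrite t0 /= prD // Ut; have := tG k.+1; rewrite big_nat_recr //=; lra.
exists (fun k => next (U k, t k)); split=> [j|j|j|j|].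
- by case: (hB j).
- by case: (hB j) => _ h _ _ x /h [].
- by case: (hB j).
- by case: (hB j).
have sub i j : (i < j)%N -> next (U i, t i) `<=` U j.
  elim: j => // j IH; rewrite ltnS leq_eqVlt => /orP[/eqP->|/IH h] x Cx /=.
    by right.
  by left; apply: h.
apply/trivIsetP => i j _ _; wlog ij : i j / (i < j)%N => [hw|_].
  rewrite neq_ltn => /orP[|] h; [apply: hw => //|rewrite setIC; apply: hw => //].
    by rewrite ltn_eqF.
  by rewrite ltn_eqF.
rewrite -subset0 => x [Ci Cj]; have [_ /(_ _ Cj) [_ nU] _ _] := hB j.
exact/nU/(sub _ _ ij).
Qed.

End Nonatomic.

(** * The Rohlin lemma *)

Lemma measurable_bigcap_count {d} {X : measurableType d} (I : countType)
    (D : set I) (F : I -> set X) :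
  (forall i, D i -> measurable (F i)) -> measurable (\bigcap_(i in D) F i).
Proof.
move=> mF; rewrite -[X in measurable X]setCK setC_bigcap; apply: measurableC.
by apply: measurable_bigcup_count => i Di; apply: measurableC; exact: mF.
Qed.

Lemma modz_uniq (K a b q r : int) : 0 <= a < K -> 0 <= b < K ->
  K * q + a = K * r + b -> a = b.
Proof.
move=> ha hb e; have := congr1 (fun z => (z %% K)%Z) e.
by rewrite ![K * _]mulrC !modzMDl !modz_small.
Qed.

Section Rohlin.
Context {R : realType} {n : nat} {d : measure_display} {X : measurableType d}.
Variables (mu : probability X R) (T : 'rV[int]_n -> X -> X).
Hypothesis hT : measure_preserving_action mu T.
Hypothesis hmu : standard_probability mu.
Hypothesis hfree : free_action mu T.
Local Notation V := 'rV[int]_n.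
Local Notation pr := (pr mu).

Section Cells.
Variables (P K : nat) (A : nat -> set X).
Hypotheses (K0 : (0 < K)%N) (KP : (K <= P)%N).
Hypothesis mA : forall k, measurable (A k).
Hypothesis sepA : forall k v x,
  cube (- (P.*2)%:Z) ((P.*2)%:Z + 1) v -> A k x -> A k (T v x) -> v = 0.
Local Notation ball := (cube (- P%:Z) (P%:Z + 1) : set V).

(** Greedy choice of a maximal separated set in each orbit: stage k adds the points of [A k] with no
    earlier marker within sup-distance P. *)
Fixpoint used k : set X :=
  if k is k.+1 then used k `|` (A k `\` tower T ball (used k)) else set0.
Definition marker k := A k `\` tower T ball (used k).
Definition markers := \bigcup_k marker k.

Lemma measurable_marker k : measurable (marker k).
Proof.
suff mU : measurable (used k).
  by apply: measurableD => //; exact: (measurable_tower hT).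
elim: k => //= k mU; apply: measurableU => //; apply: measurableD => //.
exact: (measurable_tower hT).
Qed.

Lemma used_marker k x : used k x <-> exists2 j, (j < k)%N & marker j x.
Proof.
elim: k => [|k IH] /=; first by split=> [|[]].
split=> [[/IH[j jk mx]|mx]|[j]]; first by exists j; rewrite // ltnW.
  by exists k.
by rewrite ltnS leq_eqVlt => /orP[/eqP->|jk] mx; [right|left; apply/IH; exists j].
Qed.

Lemma measurable_markers : measurable markers.
Proof. by apply: bigcup_measurable => k _; exact: measurable_marker. Qed.

(** Markers of one stage inherit the separation 2P from [A k]; markers of different stages are only
    separated up to distance P, by the greedy choice. *)
Lemma marker_sep j k v x : cube (- (P.*2)%:Z) ((P.*2)%:Z + 1) v ->
  (j = k \/ ball v) -> marker j x -> marker k (T v x) -> v = 0.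
Proof.
move=> hv [<-|bv]; first by move=> [Ax _] [Ay _]; exact: sepA Ax Ay.
have [jk|kj|->] := ltngtP j k; last by move=> [Ax _] [Ay _]; exact: sepA Ax Ay.
- move=> mx [_ []]; exists v => //; apply/used_marker; exists j => //.
  by rewrite (actA hT) addNr (act0 hT).
- move=> [_ h] my; case: h; exists (- v).
    by move=> i; rewrite !zrowE; have := bv i; lia.
  by rewrite opprK; apply/used_marker; exists k.
Qed.

Lemma disjoint_markers : disjoint_tower T (cube 0 P.+1%:Z) markers.
Proof.
move=> u v x hu hv [j _ Mj] [k _ Mk]; apply/eqP; rewrite -subr_eq0; apply/eqP.
apply: (@marker_sep j k _ (T (- u) x)) => //.
- by move=> i; rewrite !zrowE; have := hu i; have := hv i; lia.
- by right=> i; rewrite !zrowE; have := hu i; have := hv i; lia.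
- by rewrite (actA hT) addrAC subrr add0r.
Qed.

(** A point is assigned to the first stage that has a marker within distance P, and [v] is its
    position relative to that marker. By the 2P-separation within a stage, the marker is unique. *)
Definition cell k v : set X := [set x | [/\ ball v, marker k (T (- v) x) &
  forall j, (j < k)%N -> ~ tower T ball (marker j) x]].

Lemma measurable_cell k v : measurable (cell k v).
Proof.
have [bv|bv] := pselect (ball v); last first.
  suff -> : cell k v = set0 by [].
  by rewrite -subset0 => x [].
have -> : cell k v = [set x | marker k (T (- v) x)] `&`
    \bigcap_(j in [set j | (j < k)%N]) ~` tower T ball (marker j).
  by apply/seteqP; split=> [x [_ ? ?]|x [? ?]].
apply: measurableI; first exact: (measurable_act hT _ (measurable_marker k)).
apply: measurable_bigcap_count => j _; apply: measurableC.
exact: (measurable_tower hT _ (measurable_marker j)).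
Qed.

Lemma cell_inj k v k' v' x : cell k v x -> cell k' v' x -> v = v'.
Proof.
move=> [bv mv lv] [bv' mv' lv'].
have kk' : k = k'.
  have [h|h|//] := ltngtP k k'; first by case: (lv' _ h); exists v.
  by case: (lv _ h); exists v'.
subst k'; apply/eqP; rewrite -subr_eq0; apply/eqP.
apply: (@marker_sep k k _ (T (- v) x)) => //.
- by move=> i; rewrite !zrowE; have := bv i; have := bv' i; lia.
- by left.
- by rewrite (actA hT) addrAC subrr add0r.
Qed.

(** Each marker carries a grid of step K; a grid point is kept when its whole cube of side K lies in
    the cell of that marker. *)
Definition grid_base : set X := \bigcup_(kq : nat * V) \bigcap_(u in cube 0 K%:Z)
  [set x | cell kq.1 (K%:Z *: kq.2 + u) (T u x)].

Lemma measurable_grid_base : measurable grid_base.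
Proof.
apply: measurable_bigcup_count => kq _; apply: measurable_bigcap_count => u _.
exact: (measurable_act hT _ (measurable_cell _ _)).
Qed.

Lemma disjoint_grid_base : disjoint_tower T (cube 0 K%:Z) grid_base.
Proof.
move=> u u' x hu hu' [[k q] _ /(_ u hu) /= h] [[k' q'] _ /(_ u' hu') /= h'].
move: h h'; rewrite !(actA hT) !subrr !(act0 hT) => h h'.
have /rowP e := cell_inj h h'; apply/rowP => i.
by apply: (modz_uniq (hu i) (hu' i)); have := e i; rewrite !zrowE; apply.
Qed.

Local Notation shell := (shell_seq n (- (P + K)%N%:Z) K.*2 (P - K).*2.+1).

Lemma mem_shell v : v \in shell <->
  cube (- (P + K)%N%:Z) ((P + K)%N%:Z + 1) v /\
  ~ cube (- (P - K)%N%:Z) ((P - K)%N%:Z + 1) v.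
Proof.
have -> : - (P - K)%N%:Z = - (P + K)%N%:Z + K.*2%:Z by lia.
have -> : (P - K)%N%:Z + 1 =
  - (P + K)%N%:Z + K.*2%:Z + (P - K).*2.+1%:Z by lia.
have -> : (P + K)%N%:Z + 1 =
  - (P + K)%N%:Z + (K.*2 + (P - K).*2.+1 + K.*2)%N%:Z by lia.
exact: mem_shell_seq.
Qed.

(* Points at distance less than [K] lie in different cells only if some marker is
   at distance between [P - K] and [P + K] from them: cells are cut out of balls of
   radius [P]. *)
Lemma grid_cover x : (\bigcup_k A k) x -> ~ tower T [set` shell] markers x ->
  tower T (cube 0 K%:Z) grid_base x.
Proof.
move=> [k0 _ Ak0] nsh.
have exk : exists k, `[< tower T ball (marker k) x >].
  have [[v bv /used_marker[j _ mj]]|h] := pselect (tower T ball (used k0) x).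
    by exists j; apply/asboolP; exists v.
  exists k0; apply/asboolP; exists 0; first by move=> i; rewrite zrowE; lia.
  by rewrite oppr0 (act0 hT).
case: (ex_minnP exk) => k /asboolP[w bw mw] kmin {exk}.
have lk j : (j < k)%N -> ~ tower T ball (marker j) x.
  by move=> jk /asboolP /kmin; rewrite leqNgt jk.
pose u : V := \row_i (w 0%R i %% K)%Z; pose q : V := \row_i (w 0%R i %/ K)%Z.
have wE : w = K%:Z *: q + u.
  by apply/rowP => i; rewrite !zrowE mulrC -divz_eq.
have hu : cube 0 K%:Z u by move=> i; rewrite zrowE modz_ge0 ?ltz_pmod //; lia.
exists u => //; exists (k, q) => // u' hu' /=; rewrite (actA hT).
have -> : K%:Z *: q + u' = w + (u' - u) by rewrite wE -addrA [u + _]addrC subrK.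
pose t : V := u' - u; rewrite -[u' - u]/t.
have ht i : - K%:Z < t 0 i < K%:Z.
  by rewrite !zrowE; have := hu i; have := hu' i; rewrite !zrowE; lia.
(* Outside the shell, a marker within P + K of x is within P - K. So moving by less than K neither
   leaves the ball of the own marker nor enters the ball of an earlier one. *)
clearbody t; have notsh v : cube (- (P + K)%N%:Z) ((P + K)%N%:Z + 1) v ->
    markers (T (- v) x) -> cube (- (P - K)%N%:Z) ((P - K)%N%:Z + 1) v.
  move=> hv mv; apply: contrapT => nv; apply: nsh; exists v => //=.
  exact/mem_shell.
split.
- have hw : cube (- (P - K)%N%:Z) ((P - K)%N%:Z + 1) w.
    apply: notsh; last by exists k.
    by apply: cube_sub bw; lia.
  by move=> i; rewrite zrowE; have := hw i; have := ht i; lia.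
- by rewrite (actA hT) opprD addrNK.
- move=> j jk [v bv]; rewrite (actA hT) => mv.
  have e : - v + t = - (v - t) by rewrite opprB addrC.
  rewrite e in mv.
  have hz : cube (- (P - K)%N%:Z) ((P - K)%N%:Z + 1) (v - t).
    apply: notsh; last by exists j.
    by move=> i; rewrite !zrowE; have := bv i; have := ht i; lia.
  by apply: (lk j jk); exists (v - t) => //; apply: cube_sub hz; lia.
Qed.

(** Cubes of side P + 1 at the markers are disjoint, so the markers have measure at most (P+1)^(-n),
    while the shell has at most n K 4^n (P+1)^(n-1) points. The product is of order K/P. *)
Lemma pr_shell_markers :
  pr (tower T [set` shell] markers) * P.+1%:R <= (n * K * 4 ^ n)%:R.
Proof.
have mM := measurable_markers.
have h1 := pr_tower_le hT shell mM.
have dis : disjoint_tower T (cube 0 (0 + P.+1%:Z)) markers.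
  by rewrite add0r; exact: disjoint_markers.
have h2 : (P.+1 ^ n)%:R * pr markers <= 1.
  by rewrite -(pr_cube_tower hT mM dis); apply: pr_le1; exact: (measurable_tower hT).
have h3 : (size shell * P.+1 <= n * K * 4 ^ n * P.+1 ^ n)%N.
  rewrite size_shell_seq; set m := (P - K).*2.+1.
  have hm : (m <= K.*2 + m + K.*2)%N by lia.
  have := expnB_le n hm => h.
  have hb : (K.*2 + m + K.*2 <= 4 * P.+1)%N by rewrite /m; lia.
  have hb2 : ((K.*2 + m + K.*2) ^ n.-1 <= (4 * P.+1) ^ n.-1)%N.
    by case: (n.-1) => // q; rewrite leq_exp2r.
  have -> : (n * K * 4 ^ n * P.+1 ^ n = n * (4 * K) * (4 * P.+1) ^ n.-1 * P.+1)%N.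
    by rewrite expnMn; case: (n) => [|q]; rewrite ?mul0n //= !expnS; ring.
  rewrite leq_mul2r /=; apply: (leq_trans h).
  have -> : (K.*2 + m + K.*2 - m = 4 * K)%N by lia.
  by rewrite leq_mul2l hb2 orbT.
have pr0 := pr_ge0 mu markers.
apply: (@le_trans _ _ ((size shell)%:R * pr markers * P.+1%:R)).
  by rewrite ler_wpM2r.
rewrite mulrAC -natrM.
apply: (@le_trans _ _ ((n * K * 4 ^ n * P.+1 ^ n)%:R * pr markers)).
  by rewrite ler_wpM2r // ler_nat.
by rewrite natrM -mulrA -[leRHS]mulr1 ler_wpM2l.
Qed.

End Cells.

Lemma rohlin (K : nat) (e : R) : (0 < K)%N -> 0 < e -> exists F,
  [/\ measurable F, disjoint_tower T (cube 0 K%:Z) F &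
      1 - e <= pr (tower T (cube 0 K%:Z) F)].
Proof.
move=> K0 e0; pose c := (n * K * 4 ^ n)%:R : R.
pose P := maxn K (Num.bound (c / e)).
have KP : (K <= P)%N by exact: leq_maxl.
have hP : c <= e * P.+1%:R.
  have : c / e < (Num.bound (c / e))%:R by apply: archi_boundP; rewrite divr_ge0 // ltW.
  rewrite ltr_pdivrMr // mulrC => /ltW h; apply: (le_trans h).
  by rewrite ler_pM2l // ler_nat leqW // leq_maxr.
have [A [mA nA sepA]] := separated_cover hT hmu hfree (P.*2)%:Z.
exists (grid_base P K A).
have mG := measurable_grid_base P K mA.
split=> //; first by exact: disjoint_grid_base.
have h1 := pr_shell_markers K0 KP mA sepA; rewrite -/c in h1.
set sh := tower T _ (markers P A) in h1.
have mM := measurable_markers P mA.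
have msh : measurable sh by exact: (measurable_tower hT).
have hsh : pr sh <= e.
  by rewrite -(@ler_pM2r _ P.+1%:R) ?ltr0Sn //; exact: le_trans h1 hP.
set tw := tower T _ _.
have mtw : measurable tw by exact: (measurable_tower hT).
have [mnA pnA] := nA.
have cov : [set: X] `<=` (~` (\bigcup_k A k)) `|` (sh `|` tw).
  move=> x _; have [Ax|] := pselect ((\bigcup_k A k) x); last by left.
  have [|nsh] := pselect (sh x); first by right; left.
  by right; right; apply: (grid_cover K0 KP).
have := pr_le mu measurableT (measurableU _ _ mnA (measurableU _ _ msh mtw)) cov.
rewrite prT => h.
have h2 := prU_le mu mnA (measurableU _ _ msh mtw).
have h3 := prU_le mu msh mtw.
by move: h h2 h3; rewrite pnA; lra.
Qed.

End Rohlin.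

(** * Nested towers *)

Section Hierarchy.
Context {R : realType} {n : nat} {d : measure_display} {X : measurableType d}.
Variables (mu : probability X R) (T : 'rV[int]_n -> X -> X).
Hypothesis hT : measure_preserving_action mu T.
Hypothesis hmu : lebesgue_probability mu.
Hypothesis hfree : free_action mu T.
Local Notation V := 'rV[int]_n.
Local Notation pr := (pr mu).
Local Notation tower := (tower T).

(** A Rohlin tower of side Q = K + 2B gives cubes of side K with margins B. For large K the points
    at depth less than B, margins included, take a proportion at most r of it. Shrinking the base
    makes the measure exactly 1 - e, which leaves a known amount of room outside. *)
Lemma spaced_rohlin (B S : nat) (e r : R) : (0 < S)%N -> 0 < e < 1 -> 0 < r ->
  exists (K : nat) (F : set X), [/\ (S %| K)%N /\ (B.*2 < K)%N, measurable F,
    disjoint_tower T (cube (- B%:Z) (K%:Z + B%:Z)) F,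
    pr (tower (cube (- B%:Z) (K%:Z + B%:Z)) F) = 1 - e &
    1 - e - r <= pr (tower (cube B%:Z (K%:Z - B%:Z)) F)].
Proof.
move=> S0 /andP[e0 e1] r0; have [hst hna] := hmu.
pose c := (n * (4 * B))%:R : R.
pose N := maxn B.*2.+1 (Num.bound (c / r)).
pose K := (S * N)%N; pose Q := (K + B.*2)%N.
have NK : (N <= K)%N by rewrite leq_pmull.
have BN : (B.*2 < N)%N by exact: leq_maxl.
have BK : (B.*2 < K)%N by exact: leq_trans NK.
have hQ : c <= r * Q%:R.
  have : c / r < (Num.bound (c / r))%:R by apply: archi_boundP; rewrite divr_ge0 // ltW.
  rewrite ltr_pdivrMr // mulrC => /ltW h; apply: (le_trans h).
  rewrite ler_pM2l // ler_nat (leq_trans (leq_maxr B.*2.+1 _)) //.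
  by rewrite (leq_trans NK) ?leq_addr.
have Q0 : (0 < Q)%N by rewrite /Q; lia.
have [F0 [mF0 dF0 pF0]] := rohlin hT hst hfree Q0 e0.
have Qn0 : 0 < (Q ^ n)%:R :> R by rewrite ltr0n expn_gt0 Q0.
have h0 : 1 - e <= (Q ^ n)%:R * pr F0.
  rewrite -{1}(add0r Q%:Z) in dF0; rewrite -{1}(add0r Q%:Z) in pF0.
  by rewrite (pr_cube_tower hT mF0 dF0) in pF0.
have [|F1 [mF1 F10 pF1]] := @nonatomic_subset _ _ _ mu hna F0 ((1 - e) / (Q ^ n)%:R) mF0.
  apply/andP; split; last by rewrite ler_pdivrMr // mulrC.
  by apply: divr_ge0; [rewrite subr_ge0 ltW|rewrite ltW].
(* The base is translated so that the cubes of side Q start at coordinate -B. *)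
pose b : V := const_mx B%:Z.
have bE i : b 0 i = B%:Z by rewrite mxE.
pose F := [set x | F1 (T (- b) x)].
have mF : measurable F by exact: (measurable_act hT).
have pF : pr F = (1 - e) / (Q ^ n)%:R by rewrite (pr_act hT).
have FE v x : F (T (- v) x) = F1 (T (- (v + b)) x).
  by rewrite /F /= (actA hT) opprD addrC.
have dF : disjoint_tower T (cube (- B%:Z) (K%:Z + B%:Z)) F.
  move=> u v x hu hv; rewrite !FE => /F10 Fu /F10 Fv; apply: (addIr b).
  apply: (dF0 _ _ x _ _ Fu Fv).
    by move=> i; rewrite zrowE bE; have := hu i; rewrite /Q; lia.
  by move=> i; rewrite zrowE bE; have := hv i; rewrite /Q; lia.
have KBE : K%:Z + B%:Z = - B%:Z + Q%:Z by rewrite /Q; lia.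
have BK' := ltnW BK.
have KBE2 : K%:Z - B%:Z = B%:Z + (K - B.*2)%N%:Z by lia.
exists K, F; split=> //.
- by split; rewrite // dvdn_mulr.
- rewrite KBE in dF *; rewrite (pr_cube_tower hT mF dF) pF mulrC divfK //.
  by rewrite gt_eqF.
have dF' : disjoint_tower T (cube B%:Z (K%:Z - B%:Z)) F.
  by apply: disjoint_tower_sub dF => //; apply: cube_sub; lia.
rewrite KBE2 in dF' *; rewrite (pr_cube_tower hT mF dF') pF mulrA.
rewrite ler_pdivlMr //.
have hle : (K - B.*2 <= Q)%N by rewrite /Q; lia.
have h1 := expnB_le n hle.
have h2 : ((Q ^ n - (K - B.*2) ^ n) * Q <= n * (4 * B) * Q ^ n)%N.
  have -> : (n * (4 * B) * Q ^ n = n * (4 * B) * Q ^ n.-1 * Q)%N.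
    by case: (n) => [|q]; rewrite ?mul0n //= !expnS; ring.
  rewrite leq_mul2r; apply/orP; right; apply: (leq_trans h1).
  by have -> : (Q - (K - B.*2) = 4 * B)%N by rewrite /Q; lia.
have h3 : ((K - B.*2) ^ n <= Q ^ n)%N.
  by case: (n) => // q; rewrite leq_exp2r.
have Qr : 0 < Q%:R :> R by rewrite ltr0n.
set x := ((K - B.*2) ^ n)%:R : R; set y := (Q ^ n)%:R : R in Qn0 *.
have h6 : (y - x) * Q%:R <= c * y by rewrite /x /y /c -natrB // -!natrM ler_nat.
have h4 : y - x <= r * y.
  rewrite -(@ler_pM2r _ Q%:R) //; apply: (le_trans h6).
  by rewrite mulrAC ler_pM2r.
have h5 : 0 <= y - x by rewrite subr_ge0 ler_nat.
by nra.
Qed.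

(** * Cubes contained in cubes of all later levels *)

Section Chains.
Variables (K D B : nat -> nat) (H : nat -> set X).
Hypothesis K0 : forall m, (0 < K m)%N.
Hypothesis mH : forall m, measurable (H m).
Hypothesis dH : forall m,
  disjoint_tower T (cube (- (B m)%:Z) ((K m)%:Z + (B m)%:Z)) (H m).
Hypothesis DB : forall m, (D m <= B m)%N.
Hypothesis KDB : forall m, (K m + D m <= B m.+1)%N.

(** Positions of a cube of level m inside one of level m+1 that leave a margin [D m] on all
    sides. *)
Definition inner_pos m : set V :=
  cube (D m)%:Z ((K m.+1)%:Z - (K m)%:Z - (D m)%:Z + 1).

Fixpoint chain l m : set X :=
  if l is l.+1 then H m `&` tower (inner_pos m) (chain l m.+1) else H m.

Definition nested m : set X := \bigcap_l chain l m.

Lemma measurable_nested m : measurable (nested m).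
Proof.
apply: measurable_bigcap_count => l _; elim: l m => //= l IH m.
by apply: measurableI => //; exact: (measurable_tower hT).
Qed.

Lemma nested_sub m : nested m `<=` H m.
Proof. by move=> x /(_ 0%N I). Qed.

(** The position in the next cube is unique by disjointness, so the chains of all lengths pass
    through the same next base point. *)
Lemma nested_step m x : nested m x ->
  exists2 v, inner_pos m v & nested m.+1 (T (- v) x).
Proof.
have chainH l k : chain l k `<=` H k by case: l => // l y [].
move=> hx; have [_ [v hv Hv]] := hx 1%N I; exists v => // l _.
have [_ [u hu Hu]] := hx l.+1 I.
suff -> : v = u by [].
apply: (@dH m.+1 _ _ x) => //; last exact: (chainH l).
  by move=> i; have := hv i; have := K0 m; lia.
by move=> i; have := hu i; have := K0 m; lia.
Qed.

Definition deep m := tower (cube (B m)%:Z ((K m)%:Z - (B m)%:Z)) (H m).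

(** A point at depth B_(m+1), at least K_m + D_m, in its cube of level m+1 has its whole cube of
    level m there, with margin D_m. This repeats at every level. *)
Lemma deep_nested m x : (forall i, deep (m + i)%N x) ->
  tower (cube 0 (K m)%:Z) (nested m) x.
Proof.
move=> hx; have [u hu Hu] := hx 0%N; rewrite addn0 in hu Hu.
exists u; first by apply: cube_sub hu; lia.
have key l : forall i v, cube (B (m + i))%:Z ((K (m + i)%N)%:Z - (B (m + i)%N)%:Z) v ->
    H (m + i)%N (T (- v) x) -> chain l (m + i)%N (T (- v) x).
  elim: l => [|l IH] i v hv Hv //=; split=> //.
  have [w hw Hw] := hx i.+1; rewrite addnS in hw Hw.
  exists (w - v).
    move=> j; rewrite !zrowE; have := hw j; have := hv j.
    by have := DB (m + i)%N; have := KDB (m + i)%N; lia.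
  rewrite (actA hT) opprB addrAC subrr add0r -addnS; apply: IH; rewrite addnS //.
by move=> l _; have := key l 0%N u; rewrite addn0; apply.
Qed.

End Chains.

Lemma tower_hierarchy (S D : nat -> nat) (e r : nat -> R) :
  (forall m, (0 < S m)%N) -> (forall m, 0 < e m < 1) -> (forall m, 0 < r m) ->
  exists (K : nat -> nat) (F : nat -> set X),
  [/\ forall m, [/\ (0 < K m)%N, (S m %| K m)%N & measurable (F m)],
      forall m, disjoint_tower T (cube (- (D m)%:Z) ((K m)%:Z + (D m)%:Z)) (F m),
      forall m x, F m x -> exists2 v, inner_pos K D m v & F m.+1 (T (- v) x),
      forall m, pr (tower (cube 0 (K m)%:Z) (F m)) <= 1 - e m /\
        pr (tower (cube (- (D m)%:Z) ((K m)%:Z + (D m)%:Z)) (F m) `\`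
            tower (cube 0 (K m)%:Z) (F m)) <= r m &
      forall m c, (forall N, \sum_(0 <= i < N) (e (m + i)%N + r (m + i)%N) <= c) ->
        1 - c <= pr (tower (cube 0 (K m)%:Z) (F m))].
Proof.
move=> S0 e01 r0.
have /choice[f hf] : forall mB : nat * nat, exists KF : nat * set X,
    [/\ (S mB.1 %| KF.1)%N /\ (mB.2.*2 < KF.1)%N, measurable KF.2,
    disjoint_tower T (cube (- mB.2%:Z) (KF.1%:Z + mB.2%:Z)) KF.2,
    pr (tower (cube (- mB.2%:Z) (KF.1%:Z + mB.2%:Z)) KF.2) = 1 - e mB.1 &
    1 - e mB.1 - r mB.1 <= pr (tower (cube mB.2%:Z (KF.1%:Z - mB.2%:Z)) KF.2)].
  move=> [m B]; have [K [F h]] := spaced_rohlin B (S0 m) (e01 m) (r0 m).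
  by exists (K, F).
(* B_(m+1) = K_m + D_m + D_(m+1): the first two terms force nesting, the last keeps the margins
   D_(m+1) disjoint. *)
pose B := fix B m :=
  if m is m'.+1 then ((f (m', B m')).1 + D m' + D m)%N else D 0%N.
pose K m := (f (m, B m)).1; pose H m := (f (m, B m)).2.
have K0 m : (0 < K m)%N.
  by have [[_ h] _ _ _ _] := hf (m, B m); exact: leq_ltn_trans h.
have DB m : (D m <= B m)%N by case: m => //= m; exact: leq_addl.
have KDB m : (K m + D m <= B m.+1)%N by exact: leq_addr.
have mH m : measurable (H m) by have [] := hf (m, B m).
have dH m : disjoint_tower T (cube (- (B m)%:Z) ((K m)%:Z + (B m)%:Z)) (H m).
  by have [] := hf (m, B m).
have pH m : pr (tower (cube (- (B m)%:Z) ((K m)%:Z + (B m)%:Z)) (H m)) = 1 - e m.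
  by have [] := hf (m, B m).
have pdeep m : 1 - e m - r m <= pr (deep K B H m).
  by have [] := hf (m, B m).
have mtw A m : measurable (tower A (H m)) by exact: (measurable_tower hT).
pose F := nested K D H.
have mF m : measurable (F m) by exact: measurable_nested.
have mtwF A m : measurable (tower A (F m)) by exact: (measurable_tower hT).
have FH m : F m `<=` H m by exact: nested_sub.
exists K, F; split.
- by move=> m; split=> //; have [[]] := hf (m, B m).
- move=> m; apply: disjoint_tower_sub (FH m) (dH m); apply: cube_sub;
    by have := DB m; lia.
- by move=> m x; exact: (nested_step K0 dH).
- move=> m; split.
    rewrite -pH; apply: pr_le => //; apply: tower_sub (FH m); apply: cube_sub; lia.
  have sub1 : deep K B H m `<=` tower (cube (- (B m)%:Z) ((K m)%:Z + (B m)%:Z)) (H m).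
    by apply: tower_sub => //; apply: cube_sub; lia.
  have := prD mu (mtw _ m) (mtw _ m) sub1; rewrite pH => h.
  apply: (@le_trans _ _ (1 - e m - pr (deep K B H m))); last by have := pdeep m; lra.
  (* A margin point of a nested cube is not deep: its position in the tower is unique, and a deep
     position would put it inside the cube. *)
  rewrite -h; apply: pr_le; [exact: measurableD|exact: measurableD|].
  move=> x [[v hv Fv] nx]; split.
    by exists v; [apply: cube_sub hv; have := DB m; lia|exact: FH].
  move=> [u hu Hu]; apply: nx; exists v => //.
  have <- : u = v.
    apply: (@dH m _ _ x) => //; last exact: FH.
      by apply: cube_sub hu; lia.
    by apply: cube_sub hv; have := DB m; lia.
  by apply: cube_sub hu; lia.
move=> m c hc.
(* A point that is deep at all levels from m on is covered by the nested cubes of level m, so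
   countable subadditivity bounds the rest. *)
pose bad i := ~` deep K B H (m + i)%N.
have mbad i : measurable (bad i) by apply: measurableC; exact: mtw.
have hbad : pr (\bigcup_i bad i) <= c.
  apply: pr_bigcup_le => // N; apply: le_trans (hc N); apply: ler_sum => i _.
  have pbad : pr (bad i) = 1 - pr (deep K B H (m + i)%N) by apply: prC; exact: mtw.
  by rewrite pbad; have := pdeep (m + i)%N; lra.
have mb : measurable (\bigcup_i bad i) by exact: bigcup_measurable.
apply: (@le_trans _ _ (pr (~` \bigcup_i bad i))); first by rewrite prC //; lra.
apply: pr_le => //; first exact: measurableC.
move=> x nx; apply: (deep_nested DB KDB) => i.
by apply: contrapT => h; apply: nx; exists i.
Qed.

End Hierarchy.

(** * Tilings by boxes *)

Definition ibox {n : nat} (a b : 'rV[int]_n) : set 'rV[int]_n :=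
  [set v | forall i, a 0 i <= v 0 i < b 0 i].

Lemma dvdz_step (c a s b : int) : 0 < c -> (c %| s - a)%Z -> (c %| b - a)%Z ->
  s < b -> s + c <= b.
Proof.
move=> c0 /dvdzP[q hq] /dvdzP[r hr] sb.
have qr : q * c < r * c by rewrite -hq -hr; lia.
rewrite ltr_pM2r // in qr.
have : (q + 1) * c <= r * c by rewrite ler_pM2r //; lia.
by rewrite mulrDl mul1r -hq -hr; lia.
Qed.

Section Tilings.
Context {R : realType} {n : nat} {d : measure_display} {X : measurableType d}.
Variables (mu : probability X R) (T : 'rV[int]_n -> X -> X).
Hypothesis hT : measure_preserving_action mu T.
Variables (w : nat -> 'rV[nat]_n).
Hypothesis hw : forall j i, (0 < w j 0%R i)%N.
Local Notation V := 'rV[int]_n.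
Local Notation tower := (tower T).

Definition disjoint_bases (F : nat -> set X) := forall j j' u u' x,
  box (w j) u -> box (w j') u' -> F j (T (- u) x) -> F j' (T (- u') x) ->
  j = j' /\ u = u'.

(** [Y] is a disjoint union of translated boxes with types in [J]. All boxes of one type share one
    base, and disjointness holds across types as well. *)
Definition tiled (J : set nat) (Y : set X) := exists F : nat -> set X,
  [/\ forall j, measurable (F j), forall j, ~ J j -> F j = set0,
      disjoint_bases F & Y = \bigcup_j tower (box (w j)) (F j)].

Lemma tiled_bigcup (I : countType) J (Y : I -> set X) :
  (forall i, tiled J (Y i)) -> (forall i i' x, Y i x -> Y i' x -> i = i') ->
  tiled J (\bigcup_i Y i).
Proof.
move=> /choice[F hF] dY; exists (fun j => \bigcup_i F i j); split.
- by move=> j; apply: measurable_bigcup_count => i _; have [] := hF i.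
- move=> j Jj; rewrite -subset0 => x [i _]; have [_ h _ _] := hF i.
  by rewrite (h j Jj).
- move=> j j' u u' x hu hu' [i _ Fi] [i' _ Fi'].
  have ii' : i = i'.
    apply: (dY i i' x).
      by have [_ _ _ ->] := hF i; exists j => //; exists u.
    by have [_ _ _ ->] := hF i'; exists j' => //; exists u'.
  by subst i'; have [_ _ h _] := hF i; exact: (h _ _ _ _ x).
- apply/seteqP; split => [x [i _]|x [j _ [u hu [i _ Fi]]]].
    have [_ _ _ ->] := hF i => -[j _ [u hu Fu]].
    by exists j => //; exists u => //; exists i.
  by exists i => //; have [_ _ _ ->] := hF i; exists j => //; exists u.
Qed.

Lemma tiled0 J : tiled J set0.
Proof.
exists (fun=> set0); split=> //.
by apply/esym; rewrite -subset0 => x [j _ []].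
Qed.

Lemma tiledU J A B : tiled J A -> tiled J B -> A `&` B = set0 ->
  tiled J (A `|` B).
Proof.
move=> tA tB AB; pose Y (b : bool) := if b then A else B.
have -> : A `|` B = \bigcup_b Y b.
  by apply/seteqP; split=> x => [[?|?]|[[] _ ?]];
    [exists true|exists false|left|right].
apply: tiled_bigcup => [[]//|[] [] x //= h1 h2]; exfalso.
  by have : (A `&` B) x by []; rewrite AB.
by have : (A `&` B) x by []; rewrite AB.
Qed.

(** A box whose sides are multiples of those of type j is cut along a grid; the new base consists of
    the grid points. *)
Lemma tiled_grid (J : set nat) j a b F : J j -> measurable F ->
  disjoint_tower T (ibox a b) F ->
  (forall i, ((w j 0%R i)%:Z %| b 0%R i - a 0%R i)%Z) ->
  tiled J (tower (ibox a b) F).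
Proof.
move=> Jj mF dF hdiv.
pose grid := [set u | ibox a b u /\
  forall i, ((w j 0%R i)%:Z %| u 0%R i - a 0%R i)%Z].
pose G := tower grid F.
have grid_box s u : grid s -> box (w j) u -> ibox a b (s + u).
  move=> [hs ds] hu i; rewrite zrowE; have [u0 uw] := hu i; have := hs i.
  have h : (0 : int) < (w j 0 i)%:Z by rewrite ltz_nat hw.
  by have := dvdz_step h (ds i) (hdiv i); lia.
exists (fun j' => if j' == j then G else set0); split.
- by move=> j'; case: ifP => // _; exact: (measurable_tower hT).
- by move=> j' nJ; case: eqP => // e; case: nJ; rewrite e.
- move=> j1 j2 u u' x; case: eqP => [->|//]; case: eqP => [->|//] hu hu'.
  move=> [s hs]; rewrite (actA hT) -opprD => Fs.
  move=> [s' hs']; rewrite (actA hT) -opprD => Fs'; split=> //.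
  have /rowP e := dF _ _ x (grid_box _ _ hs hu) (grid_box _ _ hs' hu') Fs Fs'.
  apply/rowP => i; have := e i; rewrite !zrowE => ei.
  have [_ /(_ i)/dvdzP[q hq]] := hs; have [_ /(_ i)/dvdzP[q' hq']] := hs'.
  have [u0 uw] := hu i; have [u'0 u'w] := hu' i.
  apply: (@modz_uniq (w j 0 i)%:Z _ _ q q'); rewrite ?u0 ?u'0 //.
  by rewrite ![_%:Z * _]mulrC -hq -hq'; lia.
- apply/seteqP; split => [x [u hu Fu]|x [j' _ [u]]]; last first.
    case: eqP => [->|//] hu [s hs]; rewrite (actA hT) -opprD => Fs.
    by exists (s + u) => //; exact: grid_box.
  pose t : V := \row_i ((u 0%R i - a 0%R i) %% (w j 0%R i)%:Z)%Z.
  have wn0 i : (w j 0 i)%:Z != 0 by have := hw j i; lia.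
  exists j => //; exists t.
    by move=> i; rewrite !zrowE modz_ge0 // ltz_pmod // ltz_nat.
  rewrite eqxx; exists (u - t); last by rewrite (actBK hT).
  split=> i; rewrite !zrowE.
    have := hu i; have := divz_eq (u 0 i - a 0 i) (w j 0 i)%:Z.
    have := modz_ge0 (u 0 i - a 0 i) (wn0 i).
    have : (0 <= (u 0%R i - a 0%R i) %/ (w j 0%R i)%:Z)%Z.
      by rewrite divz_ge0 ?ltz_nat //; have := hu i; lia.
    have := hw j i; set q := (_ %/ _)%Z; set m := (_ %% _)%Z.
    move=> h1 h2 h3 h4 h5.
    have : 0 <= q * (w j 0 i)%:Z by rewrite mulr_ge0.
    by lia.
  apply/dvdzP; exists ((u 0%R i - a 0%R i) %/ (w j 0%R i)%:Z)%Z.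
  have := divz_eq (u 0 i - a 0 i) (w j 0 i)%:Z; lia.
Qed.

Definition set_coord (v : V) (i0 : 'I_n) (c : int) : V :=
  \row_i (if i == i0 then c else v 0 i).

(** Layers orthogonal to direction [i0] are cut off one by one, of thicknesses given by the list
    [s]. All sides of each layer are multiples of the sides of a single type. *)
Lemma tiled_slab (J : set nat) i0 (s : seq nat) a b F : measurable F ->
  disjoint_tower T (ibox a b) F ->
  (forall j i, J j -> i != i0 -> ((w j 0%R i)%:Z %| b 0%R i - a 0%R i)%Z) ->
  (forall j, j \in s -> J j) ->
  b 0 i0 - a 0 i0 = (\sum_(j <- s) w j 0%R i0)%N%:Z ->
  tiled J (tower (ibox a b) F).
Proof.
move=> mF; elim: s a => [|j s IH] a dF hdiv sJ.
  rewrite big_nil => e.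
  suff -> : tower (ibox a b) F = set0 by exact: tiled0.
  by rewrite -subset0 => x [u /(_ i0)]; lia.
rewrite big_cons PoszD => e; set c := a 0 i0 + (w j 0 i0)%:Z.
pose b1 := set_coord b i0 c; pose a2 := set_coord a i0 c.
have jwc : (0 : int) <= (w j 0 i0)%:Z by [].
have [sub1 sub2] : ibox a b1 `<=` ibox a b /\ ibox a2 b `<=` ibox a b.
  split=> u hu i; have := hu i; rewrite zrowE; case: eqP => [->|//]; rewrite /c; lia.
have Jj : J j by apply: sJ; rewrite inE eqxx.
have -> : tower (ibox a b) F = tower (ibox a b1) F `|` tower (ibox a2 b) F.
  apply/seteqP; split=> [x [u hu Fu]|x [|]]; last 2 first.
  - exact: tower_sub.
  - exact: tower_sub.
  have [uc|uc] := ltP (u 0 i0) c; [left|right]; exists u => // i; have := hu i;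
    by rewrite zrowE; case: eqP => [->|//]; rewrite /c in uc *; lia.
apply: tiledU.
- apply: (tiled_grid Jj mF (disjoint_tower_sub sub1 _ dF)) => // i.
  rewrite zrowE; case: eqP => [->|/eqP ne]; last exact: hdiv.
  by rewrite /c addrAC subrr add0r dvdzz.
- apply: IH.
  + exact: disjoint_tower_sub sub2 _ dF.
  + by move=> j' i Jj' ne; rewrite zrowE (negbTE ne); exact: hdiv.
  + by move=> j' hj'; apply: sJ; rewrite inE hj' orbT.
  + by rewrite zrowE eqxx /c; lia.
- rewrite -subset0 => x [[u hu Fu] [u' hu' Fu']].
  have uu' : u = u' by apply: (dF _ _ x) => //; [exact: sub1|exact: sub2].
  subst u'; have := hu i0; have := hu' i0; rewrite !zrowE eqxx; lia.
Qed.

End Tilings.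

(** * Filling a large cube around small ones *)

Section Filling.
Context {R : realType} {n : nat} {d : measure_display} {X : measurableType d}.
Variables (mu : probability X R) (T : 'rV[int]_n -> X -> X).
Hypothesis hT : measure_preserving_action mu T.
Variables (w : nat -> 'rV[nat]_n).
Hypothesis hw : forall j i, (0 < w j 0%R i)%N.
Local Notation V := 'rV[int]_n.
Local Notation tower := (tower T).

Variables (J : set nat) (M S K K' : nat) (F F' : set X).
Local Notation D := (M + S)%N.
Hypothesis hM : forall i m, (M <= m)%N ->
  exists2 s : seq nat, (forall j, j \in s -> J j) & m = (\sum_(j <- s) w j 0%R i)%N.
Hypotheses (S0 : (0 < S)%N) (SK' : (S %| K')%N).
Hypothesis wS : forall j i, J j -> (w j 0%R i %| S)%N.
Hypothesis wK : forall j i, J j -> (w j 0%R i %| K)%N.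
Hypotheses (mF : measurable F) (mF' : measurable F').
Hypothesis dF : disjoint_tower T (cube (- D%:Z) (K%:Z + D%:Z)) F.
Hypothesis dF' : disjoint_tower T (cube 0 K'%:Z) F'.
Let inner : set V := cube D%:Z (K'%:Z - K%:Z - D%:Z + 1).
Hypothesis FF' : forall x, F x -> exists2 v, inner v & F' (T (- v) x).

(* [lo] and [hi] bound the smallest box of the [S]-grid of the large cube that
   leaves a margin of at least [M] around the small cube at position [v]. *)
Let lo (a : int) : int := ((a - M%:Z) %/ S%:Z)%Z * S%:Z.
Let hi (a : int) : int := (((a + K%:Z + M%:Z) %/ S%:Z)%Z + 1) * S%:Z.

Let SZ0 : (0 : int) < S%:Z. Proof. by rewrite ltz_nat. Qed.

Lemma lo_bounds a : a - D%:Z < lo a <= a - M%:Z.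
Proof.
have := divz_eq (a - M%:Z) S%:Z; rewrite -/(lo a).
have := ltz_pmod (a - M%:Z) SZ0; have := modz_ge0 (a - M%:Z) (lt0r_neq0 SZ0).
lia.
Qed.

Lemma hi_bounds a : a + K%:Z + M%:Z < hi a <= a + K%:Z + D%:Z.
Proof.
have := divz_eq (a + K%:Z + M%:Z) S%:Z; rewrite /hi mulrDl mul1r.
have := ltz_pmod (a + K%:Z + M%:Z) SZ0.
have := modz_ge0 (a + K%:Z + M%:Z) (lt0r_neq0 SZ0).
lia.
Qed.

(** The base is split by position in the large cube, since the shape of the extended box depends on
    that position. *)
Definition at_pos (v : V) : set X := [set x | [/\ inner v, F x & F' (T (- v) x)]].

Definition ext_box (v : V) : set V :=
  ibox (\row_i (lo (v 0 i) - v 0 i)) (\row_i (hi (v 0 i) - v 0 i)).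

Definition extension : set X := \bigcup_v tower (ext_box v) (at_pos v).

Lemma measurable_at_pos v : measurable (at_pos v).
Proof.
have [iv|niv] := pselect (inner v); last first.
  by suff -> : at_pos v = set0 by []; rewrite -subset0 => x [].
have -> : at_pos v = F `&` [set x | F' (T (- v) x)].
  by apply/seteqP; split=> x [] //.
by apply: measurableI => //; exact: (measurable_act hT).
Qed.

Lemma ext_box_sub v : ext_box v `<=` cube (- D%:Z) (K%:Z + D%:Z).
Proof.
move=> u hu i; have := hu i; rewrite !zrowE.
have := lo_bounds (v 0 i); have := hi_bounds (v 0 i); lia.
Qed.

Lemma measurable_extension : measurable extension.
Proof.
apply: measurable_bigcup_count => v _.
exact/(measurable_tower hT)/measurable_at_pos.
Qed.

Lemma sub_extension : tower (cube 0 K%:Z) F `<=` extension.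
Proof.
move=> x [u hu Fu]; have [v iv F'v] := FF' Fu.
exists v => //; exists u => // i; rewrite !zrowE; have := hu i.
have := lo_bounds (v 0 i); have := hi_bounds (v 0 i); lia.
Qed.

Lemma extension_sub : extension `<=` tower (cube (- D%:Z) (K%:Z + D%:Z)) F.
Proof. by move=> x [v _ [u /ext_box_sub hu [_ Fu _]]]; exists u. Qed.

Lemma ext_pos v u : inner v -> ext_box v u -> cube 0 K'%:Z (u + v).
Proof.
move=> hv hu i; have := hv i; have := hu i; rewrite !zrowE => h1 h2.
have h3 := hi_bounds (v 0 i).
have : 0 <= lo (v 0 i).
  by rewrite /lo mulr_ge0 // divz_ge0 //; have := hv i; lia.
lia.
Qed.

Lemma extension_sub' : extension `<=` tower (cube 0 K'%:Z) F'.
Proof.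
move=> x [v _ [u hu [iv Fu F'v]]]; exists (u + v); first exact: ext_pos.
by move: F'v; rewrite (actA hT) opprD addrC.
Qed.

(** Membership in coordinates of the large cube: [r] is the position of z there, and [v] that of a
    small cube whose extended box contains it. *)
Lemma extensionP z r : cube 0 K'%:Z r -> F' (T (- r) z) -> extension z <->
  exists v, [/\ inner v, F (T (v - r) z) &
    forall i, lo (v 0 i) <= r 0 i < hi (v 0 i)].
Proof.
move=> hr Fr; split=> [[v _ [u hu [iv Fu F'v]]]|[v [iv Fv hv]]].
  have e : u + v = r.
    apply: (dF' (x := z)) => //; first exact: ext_pos.
    by move: F'v; rewrite (actA hT) opprD addrC.
  exists v; split=> //; first by rewrite -e opprD addrCA subrr addr0.
  by move=> i; have := hu i; rewrite -e !zrowE; lia.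
exists v => //; exists (r - v).
  by move=> i; have := hv i; rewrite !zrowE; lia.
by rewrite /at_pos /= (actA hT) opprB; split=> //; rewrite addrA addNr add0r.
Qed.

Let round (r : V) : V := \row_i ((r 0%R i %/ S%:Z)%Z * S%:Z).

Lemma cube_round r : cube 0 K'%:Z r -> cube 0 K'%:Z (round r) /\
  cube 0 S%:Z (r - round r).
Proof.
move=> hr; split=> i; rewrite !zrowE; have := hr i;
  have := divz_eq (r 0 i) S%:Z; have := ltz_pmod (r 0 i) SZ0;
  have := modz_ge0 (r 0 i) (lt0r_neq0 SZ0); last by lia.
move=> h1 h2 h3 h4.
have : 0 <= (r 0%R i %/ S%:Z)%Z * S%:Z.
  by rewrite mulr_ge0 // divz_ge0 //; lia.
lia.
Qed.

(** All faces of the extended boxes lie on the S-grid, so a grid cell lies entirely inside or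
    entirely outside the extension. *)
Lemma extension_round z r : cube 0 K'%:Z r -> F' (T (- r) z) ->
  extension z <-> extension (T (- (r - round r)) z).
Proof.
move=> hr Fr; have [hr1 _] := cube_round hr.
have e : T (- round r) (T (- (r - round r)) z) = T (- r) z.
  by rewrite (actA hT) opprB addKr.
have e2 v : T (v - round r) (T (- (r - round r)) z) = T (v - r) z.
  by rewrite (actA hT) opprB addrA subrK.
have hrnd (v : V) i : (lo (v 0 i) <= round r 0 i < hi (v 0 i)) =
    (lo (v 0 i) <= r 0 i < hi (v 0 i)).
  rewrite /lo /hi !zrowE ler_pM2r // ltr_pM2r //.
  by rewrite lez_divRL // ltz_divLR.
rewrite (extensionP hr Fr) (extensionP hr1); last by rewrite e.
split=> -[v [iv Fv hv]]; exists v; split=> //.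
- by rewrite e2.
- by move=> i; rewrite hrnd.
- by rewrite -e2.
- by move=> i; rewrite -hrnd.
Qed.

Lemma complement_cubes : exists G, [/\ measurable G,
  disjoint_tower T (cube 0 S%:Z) G &
  tower (cube 0 K'%:Z) F' `\` extension = tower (cube 0 S%:Z) G].
Proof.
(* The lower corners of the grid cells that avoid the extension. *)
pose G := tower [set s | cube 0 K'%:Z s /\ forall i, (S%:Z %| s 0%R i)%Z] F'
  `\` extension.
have SK : (S%:Z %| K'%:Z - 0)%Z by rewrite subr0.
have add_cube (s u : V) : cube 0 K'%:Z s -> (forall i, (S%:Z %| s 0%R i)%Z) ->
    cube 0 S%:Z u -> cube 0 K'%:Z (s + u).
  move=> hs ds hu i; rewrite zrowE; have := hs i; have := hu i.
  have ds0 : (S%:Z %| s 0%R i - 0)%Z by rewrite subr0.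
  have := dvdz_step SZ0 ds0 SK; lia.
exists G; split.
- by apply: measurableD; [exact: (measurable_tower hT)|exact: measurable_extension].
- move=> u u' x hu hu' [[s [hs ds]]]; rewrite (actA hT) -opprD => Fs _.
  move=> [[s' [hs' ds']]]; rewrite (actA hT) -opprD => Fs' _.
  have /rowP e := dF' (x := x) (add_cube _ _ hs ds hu) (add_cube _ _ hs' ds' hu') Fs Fs'.
  apply/rowP => i; have /dvdzP[q hq] := ds i; have /dvdzP[q' hq'] := ds' i.
  apply: (@modz_uniq S%:Z _ _ q q' (hu i) (hu' i)).
  by have := e i; rewrite !zrowE hq hq' ![_ * S%:Z]mulrC.
- apply/seteqP; split=> [x [[r hr Fr] nx]|x [u hu [[s [hs ds] Fs] nx]]].
    have [h1 h2] := cube_round hr; exists (r - round r) => //; split.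
      exists (round r); last by rewrite (actA hT) opprB addKr.
      by split=> // i; rewrite zrowE dvdz_mull.
    by move=> /(extension_round hr Fr).
  rewrite (actA hT) -opprD in Fs.
  have hsu := add_cube _ _ hs ds hu.
  split; first by exists (s + u).
  move=> /(extension_round hsu Fs); apply: contra_not nx.
  suff -> : s + u - round (s + u) = u by [].
  apply/rowP => i; rewrite !zrowE; have /dvdzP[q ->] := ds i.
  rewrite divzMDl ?gt_eqF // divz_small ?addr0; first by rewrite addrAC subrr add0r.
  by have := hu i; lia.
Qed.

(** The slab added when coordinate [i] is extended: earlier coordinates already have their full
    extended range, later ones still range over [0, K). The flag [b] selects the upper or the lower
    side. *)
Let slab_lo (v : V) (i : 'I_n) (b : bool) : V := \row_j
  (if (j < i)%N then lo (v 0 j) - v 0 j else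
   if j == i then (if b then K%:Z else lo (v 0 j) - v 0 j) else 0).
Let slab_hi (v : V) (i : 'I_n) (b : bool) : V := \row_j
  (if (j < i)%N then hi (v 0 j) - v 0 j else
   if j == i then (if b then hi (v 0 j) - v 0 j else 0) else K%:Z).

Lemma slab_ext v i b : ibox (slab_lo v i b) (slab_hi v i b) `<=` ext_box v.
Proof.
move=> u hu j; have := hu j; rewrite !zrowE.
have := lo_bounds (v 0 j); have := hi_bounds (v 0 j).
by case: ifP => _ //; case: eqP => _; case: b {hu}; lia.
Qed.

(* A point of the extension outside the small cube belongs to the slab indexed
   by the largest coordinate in which it leaves that cube. *)
Lemma slab_exists v u : ext_box v u -> ~ cube 0 K%:Z u ->
  exists i b, ibox (slab_lo v i b) (slab_hi v i b) u.
Proof.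
move=> hu nu; pose out (i : 'I_n) := ~~ (0 <= u 0 i < K%:Z).
have [i0 oi0] : exists i, out i.
  apply: contrapT => h; apply: nu => i; apply: contrapT => /negP ui.
  by apply: h; exists i.
case: (arg_maxnP (fun i : 'I_n => nat_of_ord i) oi0) => i oi imax.
have hin (j : 'I_n) : (i < j)%N -> 0 <= u 0 j < K%:Z.
  move=> ij; apply: contrapT => /negP /imax /= h.
  by have := leq_trans ij h; rewrite ltnn.
exists i, (0 <= u 0 i) => j; have := hu j; rewrite !zrowE.
have [ji|ij|/val_inj ->] := ltngtP j i.
- by [].
- have /negbTE -> : j != i by rewrite -val_eqE /= gtn_eqF.
  by move=> _; exact: hin.
- by rewrite eqxx; move: oi; rewrite /out; case: (leP 0 (u 0 i)) => h1 h2 h3; lia.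
Qed.

(** The index is recovered from the point, hence distinct slabs are disjoint. *)
Lemma slab_out v i b u : ibox (slab_lo v i b) (slab_hi v i b) u ->
  [/\ ~~ (0 <= u 0 i < K%:Z), (0 <= u 0 i) = b &
      forall j : 'I_n, (i < j)%N -> 0 <= u 0 j < K%:Z].
Proof.
move=> hu; split.
- by have := hu i; rewrite !zrowE ltnn eqxx; case: b {hu}; lia.
- by have := hu i; rewrite !zrowE ltnn eqxx; case: b {hu}; lia.
- move=> j ij; have := hu j; rewrite !zrowE ltnNge (ltnW ij) /=.
  by have /negbTE -> : j != i by rewrite -val_eqE /= gtn_eqF.
Qed.

Lemma tiled_extension : tiled T w J (extension `\` tower (cube 0 K%:Z) F).
Proof.
pose piece (vib : V * ('I_n * bool)) :=
  tower (ibox (slab_lo vib.1 vib.2.1 vib.2.2) (slab_hi vib.1 vib.2.1 vib.2.2))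
    (at_pos vib.1).
have -> : extension `\` tower (cube 0 K%:Z) F = \bigcup_vib piece vib.
  apply/seteqP; split=> [x [[v _ [u hu hv]] nx]|x [[v [i b]] _ [u hu hv]]].
    have [|i [b hib]] := slab_exists hu.
      by move=> hu'; apply: nx; exists u => //; case: hv.
    by exists (v, (i, b)) => //; exists u.
  have huv := slab_ext hu; split; first by exists v => //; exists u.
  move=> [u' hu' Fu']; have [/negP nu _ _] := slab_out hu; apply: nu.
  suff -> : u = u' by exact: hu'.
  apply: (dF (x := x)) => //; first exact: ext_box_sub huv.
    by apply: cube_sub hu'; lia.
  by case: hv.
apply: tiled_bigcup => // [[v [i b]]|[v [i b]] [v' [i' b']] x].
  have sl : ibox (slab_lo v i b) (slab_hi v i b) `<=` cube (- D%:Z) (K%:Z + D%:Z).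
    by apply: subset_trans (@ext_box_sub v); exact: slab_ext.
  (* The thickness of the slab, at least M and so a sum of i-th sides. Its other sides are multiples
     of S or equal to K, hence divisible by the sides of all types in [J]. *)
  pose m := if b then hi (v 0 i) - v 0 i - K%:Z else v 0 i - lo (v 0 i).
  have mM : (M <= `|m|)%N /\ m = `|m|%N%:Z.
    rewrite /m; have := lo_bounds (v 0 i); have := hi_bounds (v 0 i).
    by case: (b); lia.
  have [s sJ hs] := hM i mM.1.
  apply: (@tiled_slab _ _ _ _ mu T hT w hw J i s) => //.
  - exact: measurable_at_pos.
  - by apply: disjoint_tower_sub sl _ dF => y [].
  - move=> j i' Jj ne; rewrite !zrowE; case: ifP => _.
      have -> : hi (v 0 i') - v 0 i' - (lo (v 0 i') - v 0 i') = hi (v 0 i') - lo (v 0 i').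
        by lia.
      rewrite /hi /lo -mulrBl; apply: dvdz_mull.
      by rewrite dvdzE /=; exact: wS.
    by rewrite (negbTE ne) subr0 dvdzE /=; exact: wK.
  - by rewrite -hs -mM.2 !zrowE ltnn eqxx /m; case: (b) => /=; lia.
move=> [u hu [iv Fu F'v]] [u' hu' [iv' Fu' F'v']].
have uu' : u = u'.
  apply: (dF (x := x)) => //.
    exact/ext_box_sub/(slab_ext hu).
  exact/ext_box_sub/(slab_ext hu').
subst u'; have vv' : v = v'.
  apply: (dF' (x := T (- u) x)) => //.
    by apply: cube_sub iv; lia.
  by apply: cube_sub iv'; lia.
subst v'; have [out1 b1 h1] := slab_out hu; have [out2 b2 h2] := slab_out hu'.
have ii' : i = i'.
  have [h|h|/val_inj //] := ltngtP i i'.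
    by rewrite (h1 _ h) in out2.
  by rewrite (h2 _ h) in out1.
by subst i'; move: b1 b2 => /= <- <-.
Qed.

End Filling.

(** * Combining the scales *)

Lemma sum_flatten_nseq (a : nat -> nat) q s :
  (\sum_(j <- flatten (nseq q s)) a j = q * \sum_(j <- s) a j)%N.
Proof.
elim: q => [|q IH]; first by rewrite big_nil.
by rewrite /= big_cat /= IH mulSn.
Qed.

Lemma mem_flatten_nseq q (s : seq nat) j : j \in flatten (nseq q s) -> j \in s.
Proof. by case/flattenP => s' /nseqP[-> _]. Qed.

(* The differences of two sums form a group; its least positive element divides
   every [a j], so it is 1, and two consecutive integers [y], [y + 1] are sums. *)
Lemma gcd_seq_sums (a : nat -> nat) : (0 < a 0%N)%N -> is_gcd_seq a 1 ->
  exists M k, forall m, (M <= m)%N -> exists2 s : seq nat,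
    (forall j, j \in s -> (j < k)%N) & m = (\sum_(j <- s) a j)%N.
Proof.
move=> a0 [_ gcda].
pose diff h := exists s s', (\sum_(j <- s) a j = \sum_(j <- s') a j + h)%N.
have exh : exists h, `[< (0 < h)%N /\ diff h >].
  exists (a 0%N); apply/asboolP; split=> //; exists [:: 0%N], [::].
  by rewrite big_seq1 big_nil add0n.
case: (ex_minnP exh) => h /asboolP[h0 [s [s' ss']]] hmin.
have h1 : h = 1%N.
  apply/eqP; rewrite -dvdn1; apply: gcda => j.
  rewrite /dvdn; apply: contraT; rewrite -lt0n => r0.
  have : diff (a j %% h)%N.
    (* The remainder is a_j - q h with q the quotient, and h is the sum over [s] minus the sum over
       [s']. *)
    exists (j :: flatten (nseq (a j %/ h) s')), (flatten (nseq (a j %/ h) s)).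
    rewrite big_cons !sum_flatten_nseq ss' {1}(divn_eq (a j) h).
    ring.
  move=> dr; have /hmin : `[< (0 < a j %% h)%N /\ diff (a j %% h)%N >].
    exact/asboolP.
  by rewrite leqNgt ltn_pmod.
rewrite {}h1 {h h0 hmin} in ss'.
(* Adding one term a_0 to both sums makes y positive. *)
pose t := 0%N :: s; pose t' := 0%N :: s'.
pose y := (\sum_(j <- t') a j)%N.
have ty : (\sum_(j <- t) a j = y.+1)%N by rewrite /y !big_cons ss'; lia.
have y0 : (0 < y)%N by rewrite /y big_cons ltn_addr.
(* With m = q y + r and r < y <= q, one has m = (q - r) y + r (y + 1). *)
exists (y * y)%N, (\max_(j <- t ++ t') j).+1 => m hm.
have hq : (y <= m %/ y)%N by rewrite leq_divRL.
have hr : (m %% y < y)%N by rewrite ltn_pmod.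
exists (flatten (nseq (m %/ y - m %% y) t') ++ flatten (nseq (m %% y) t)).
  move=> j; rewrite mem_cat ltnS => jin.
  apply: (@leq_bigmax_seq _ _ xpredT id) => //; rewrite mem_cat.
  by case/orP: jin => /mem_flatten_nseq ->; rewrite ?orbT.
rewrite big_cat /= !sum_flatten_nseq ty -/y.
rewrite mulnS addnCA -mulnDl subnK; last by lia.
by rewrite addnC -divn_eq.
Qed.

Lemma gcd_rows_sums n (w : nat -> 'rV[nat]_n) :
  (forall j i, (0 < w j 0%R i)%N) ->
  (forall i, is_gcd_seq (fun j => w j 0%R i) 1) ->
  exists M k, forall i m, (M <= m)%N -> exists2 s : seq nat,
    (forall j, j \in s -> (j < k)%N) & m = (\sum_(j <- s) w j 0%R i)%N.
Proof.
move=> w0 wgcd.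
have /choice[Mk hMk] : forall i, exists Mk : nat * nat, forall m, (Mk.1 <= m)%N ->
    exists2 s : seq nat, (forall j, j \in s -> (j < Mk.2)%N) &
      m = (\sum_(j <- s) w j 0%R i)%N.
  move=> i; have [M [k h]] := gcd_seq_sums (w0 0%N i) (wgcd i).
  by exists (M, k).
exists (\max_i (Mk i).1), (\max_i (Mk i).2) => i m hm.
have [|s hs ->] := hMk i m.
  by apply: leq_trans hm; exact: (leq_bigmax i).
exists s => // j /hs h; apply: leq_trans h _.
exact: (leq_bigmax i).
Qed.

(** * Sharing out the measure of the cubes among the types *)

Section Allocation.
Variable R : realType.

(** Supermodularity of the minimum, which makes the shares below nonnegative. *)
Lemma min_second_difference (a a' b b' : R) : a <= a' -> b <= b' ->
  0 <= Num.min a' b' - Num.min a b' - Num.min a' b + Num.min a b.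
Proof.
move=> aa bb.
case: (leP a' b') => h1; case: (leP a b') => h2; case: (leP a' b) => h3;
  case: (leP a b) => h4; lra.
Qed.

(* With [a] and [b] the partial sums of [q] and [c], [t m j] is the length of
   the intersection of [a j, a j.+1] and [b m, b m.+1]. *)
Lemma allocation (q c : nat -> R) (f : nat -> nat) :
  (forall j, 0 <= q j) -> (forall m, 0 <= c m) ->
  (forall N e, 0 < e -> exists M,
    \sum_(0 <= j < N) q j <= \sum_(0 <= m < M) c m + e) ->
  (forall m, \sum_(0 <= i < m.+1) c i <= \sum_(0 <= j < f m) q j) ->
  exists t : nat -> nat -> R,
  [/\ forall m j, 0 <= t m j, forall m N, \sum_(0 <= j < N) t m j <= c m,
      forall j M, \sum_(0 <= m < M) t m j <= q j,
      forall j e, 0 < e -> exists M, q j - e <= \sum_(0 <= m < M) t m j &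
      forall m j, (f m <= j)%N -> t m j = 0].
Proof.
move=> q0 c0 hqc hf.
pose a N := \sum_(0 <= j < N) q j; pose b M := \sum_(0 <= m < M) c m.
have a0 : a 0%N = 0 by rewrite /a big_geq.
have b0 : b 0%N = 0 by rewrite /b big_geq.
have aS j : a j.+1 = a j + q j by rewrite /a big_nat_recr.
have bS j : b j.+1 = b j + c j by rewrite /b big_nat_recr.
have a_ge0 j : 0 <= a j by apply: sumr_ge0.
have b_ge0 j : 0 <= b j by apply: sumr_ge0.
have a_mono i j : (i <= j)%N -> a i <= a j.
  elim: j => [|j IH]; first by rewrite leqn0 => /eqP ->.
  rewrite leq_eqVlt => /orP[/eqP-> //|/IH h]; rewrite aS; have := q0 j; lra.
(* Written as a second difference of minima, the length telescopes in both indices. *)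
pose t m j := Num.min (a j.+1) (b m.+1) - Num.min (a j) (b m.+1)
  - Num.min (a j.+1) (b m) + Num.min (a j) (b m).
have tm j M : \sum_(0 <= m < M) t m j = Num.min (a j.+1) (b M) - Num.min (a j) (b M).
  elim: M => [|M IH]; first by rewrite big_geq // b0 !min_r // subrr.
  by rewrite big_nat_recr //= IH /t; ring.
have tj m N : \sum_(0 <= j < N) t m j = Num.min (a N) (b m.+1) - Num.min (a N) (b m).
  elim: N => [|N IH]; first by rewrite big_geq // a0 !min_l // subrr.
  by rewrite big_nat_recr //= IH /t; ring.
exists t; split.
- move=> m j; apply: min_second_difference; first by rewrite aS; have := q0 j; lra.
  by rewrite bS; have := c0 m; lra.
- move=> m N; rewrite tj bS; have := c0 m.
  by case: (leP (a N) (b m)); case: (leP (a N) (b m + c m)); lra.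
- move=> j M; rewrite tm aS; have := q0 j.
  by case: (leP (a j) (b M)); case: (leP (a j + q j) (b M)); lra.
- move=> j e e0; have [M hM] := hqc j.+1 e e0; exists M; rewrite tm.
  rewrite -/(a _) -/(b _) aS in hM *; have := q0 j.
  by case: (leP (a j) (b M)); case: (leP (a j + q j) (b M)); lra.
- move=> m j fj; have h : b m.+1 <= a j by apply: le_trans (a_mono _ _ fj); exact: hf.
  have h2 : a j <= a j.+1 by exact: a_mono.
  have h3 : b m <= b m.+1 by rewrite bS; have := c0 m; lra.
  by rewrite /t !min_r //; lra.
Qed.

End Allocation.

(** * Decomposition into cubes and thin slabs *)

Section Decomposition.
Context {R : realType} {n : nat} {d : measure_display} {X : measurableType d}.
Variables (mu : probability X R) (T : 'rV[int]_n -> X -> X).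
Hypothesis hT : measure_preserving_action mu T.
Hypothesis hmu : lebesgue_probability mu.
Hypothesis hfree : free_action mu T.
Variables (w : nat -> 'rV[nat]_n).
Hypothesis hw : forall j i, (0 < w j 0%R i)%N.
Local Notation pr := (pr mu).
Local Notation tower := (tower T).

Lemma measurable_tiled J Y : tiled T w J Y -> measurable Y.
Proof.
move=> [F [mF _ _ ->]]; apply: bigcup_measurable => j _.
exact: (measurable_tower hT).
Qed.

(** [E 0] consists of the cubes of level 0, [E m.+1] of the grid cubes left in level m+1 outside the
    extensions of level m, and [Z m] of the slabs of these extensions. The sum [W] is the measure
    covered by the cubes of level m. *)
Lemma cube_decomposition (J : set nat) (M : nat) (S : nat -> nat)
    (e r : nat -> R) :
  (forall i m, (M <= m)%N -> exists2 s : seq nat,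
    (forall j, j \in s -> J j) & m = (\sum_(j <- s) w j 0%R i)%N) ->
  (forall m, (0 < S m)%N) ->
  (forall m j i, J j -> (w j 0%R i %| S m)%N) ->
  (forall m, 0 < e m < 1) -> (forall m, 0 < r m) ->
  exists (s : nat -> nat) (G Z : nat -> set X),
    let E m := tower (cube 0 (s m)%:Z) (G m) in
  [/\ forall m, (0 < s m)%N /\ (S m %| s m)%N,
      forall m, measurable (G m) /\ disjoint_tower T (cube 0 (s m)%:Z) (G m),
      forall m, tiled T w J (Z m) /\ pr (Z m) <= r m,
      (forall m m' x, E m x -> E m' x -> m = m') /\
      (forall m m' x, Z m x -> Z m' x -> m = m') /\
      (forall m m' x, E m x -> ~ Z m' x) &
      forall m, let W := \sum_(0 <= i < m.+1) pr (E i) + \sum_(0 <= i < m) pr (Z i) in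
        W <= 1 - e m /\ forall c,
        (forall N, \sum_(0 <= i < N) (e (m + i)%N + r (m + i)%N) <= c) -> 1 - c <= W].
Proof.
move=> hM S0 wS e01 r0.
(* M for the least thickness of a slab, S_(m+1) for rounding to the grid of the next level. *)
pose D m := (M + S m.+1)%N.
have [K [F [hK dF FF' prF covF]]] := tower_hierarchy hT hmu hfree D S0 e01 r0.
have mF m : measurable (F m) by case: (hK m).
have wK m j i : J j -> (w j 0%R i %| K m)%N.
  by move=> Jj; apply: (@dvdn_trans (S m)); [exact: wS|case: (hK m)].
have SK m : (S m %| K m)%N by case: (hK m).
pose W m := tower (cube 0 (K m)%:Z) (F m).
pose ext m := extension T M (S m.+1) (K m) (K m.+1) (F m) (F m.+1).
have dW m : disjoint_tower T (cube 0 (K m)%:Z) (F m).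
  by apply: disjoint_tower_sub (dF m) => //; apply: cube_sub; lia.
have mW m : measurable (W m) by exact: (measurable_tower hT).
have mext m : measurable (ext m) by exact: (measurable_extension hT).
have Wext m : W m `<=` ext m.
  by apply: (sub_extension (S0 m.+1) (SK m.+1)); exact: FF'.
have extW m : ext m `<=` W m.+1.
  exact: (extension_sub' hT (S0 m.+1) (SK m.+1)).
have WW m : W m `<=` W m.+1 by exact: subset_trans (Wext m) (extW m).
have Wmono i j : (i <= j)%N -> W i `<=` W j.
  elim: j => [|j IH]; first by rewrite leqn0 => /eqP ->.
  by rewrite leq_eqVlt => /orP[/eqP-> //|/IH h]; exact: subset_trans h (WW j).
have /choice[G' hG'] : forall m, exists G, [/\ measurable G,
    disjoint_tower T (cube 0 (S m.+1)%:Z) G &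
    W m.+1 `\` ext m = tower (cube 0 (S m.+1)%:Z) G].
  by move=> m; exact: (complement_cubes hT M (K m) (S0 _) (SK _) (mF m) (mF _) (dW _)).
pose s m := if m is m'.+1 then S m else K 0%N.
pose G m := if m is m'.+1 then G' m' else F 0%N.
pose Z m := ext m `\` W m.
pose E m := tower (cube 0 (s m)%:Z) (G m).
have ES m : E m.+1 = W m.+1 `\` ext m by have [_ _ ->] := hG' m.
have EW m : E m `<=` W m by case: m => // m; rewrite ES; exact: subDsetl.
have EnW m : E m.+1 `&` W m = set0.
  by rewrite ES -subset0 => x [[_ nx] /Wext].
have ZW m : Z m `<=` W m.+1 by move=> x [/extW].
have mE m : measurable (E m).
  case: m => [|m]; first exact: (mW 0%N).
  by rewrite ES; apply: measurableD.
have mZ m : measurable (Z m) by exact: measurableD.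
have EE m m' x : (m < m')%N -> E m x -> ~ E m' x.
  case: m' => // m' mm' /EW Wx Ex.
  have : (E m'.+1 `&` W m') x by split=> //; apply: (Wmono m).
  by rewrite EnW.
have ZZ m m' x : (m < m')%N -> Z m x -> ~ Z m' x.
  by move=> mm' /ZW Wx [_]; apply; apply: (Wmono m.+1).
exists s, G, Z; split.
- case=> [|m]; first by have [] := hK 0%N.
  by split; [exact: S0|exact: dvdnn].
- case=> [|m]; first by split; [exact: mF|exact: dW].
  by have [] := hG' m.
- move=> m; split.
    apply: (@tiled_extension _ _ _ _ mu T hT w hw J M (S m.+1) (K m) (K m.+1)) => //.
    + exact: wS.
    + exact: wK.
    + exact: dF.
  apply: le_trans (prF m).2; apply: pr_le => //.
    by apply: measurableD => //; exact: (measurable_tower hT).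
  by move=> x [/(extension_sub (S0 m.+1) (SK m.+1)) hx nx].
- split; last split.
  + move=> m m' x Ex Ex'; have [h|h|//] := ltngtP m m'.
      by case: (EE _ _ x h Ex).
    by case: (EE _ _ x h Ex').
  + move=> m m' x Ex Ex'; have [h|h|//] := ltngtP m m'.
      by case: (ZZ _ _ x h Ex).
    by case: (ZZ _ _ x h Ex').
  + move=> m m' x Ex Zx; have [h|h] := leqP m m'.
      by case: Zx => _; apply; apply: (Wmono m) => //; exact: EW.
    case: m Ex h => // m Ex h; have [h2|h2] := ltnP m' m.
      have : (E m.+1 `&` W m) x by split=> //; apply: (Wmono m'.+1) => //; exact: ZW.
      by rewrite EnW.
    have e1 : m = m' by lia.
    by subst m'; move: Ex; rewrite [tower _ _]ES => -[_]; apply; case: Zx.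
move=> m; have -> : \sum_(0 <= i < m.+1) pr (tower (cube 0 (s i)%:Z) (G i)) +
    \sum_(0 <= i < m) pr (Z i) = pr (W m).
  elim: m => [|m IH]; first by rewrite big_nat1 big_geq // addr0.
  rewrite big_nat_recr //= [X in _ + X]big_nat_recr //= addrACA IH.
  have e1 := prD mu (mW m.+1) (mext m) (extW m).
  have e2 := prD mu (mext m) (mW m) (Wext m).
  by rewrite [tower _ _](ES m) e1 e2; ring.
by split; [case: (prF m)|exact: covF].
Qed.

End Decomposition.

(** * Measures of disjoint unions, and single-type tilings as Rohlin towers *)

Section DisjointSums.
Context {R : realType} {d : measure_display} {X : measurableType d}.
Variable mu : probability X R.
Local Notation pr := (pr mu).

Lemma sum_pr_le (F : nat -> set X) N : (forall i, measurable (F i)) ->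
  trivIset setT F -> \sum_(0 <= i < N) pr (F i) <= pr (\bigcup_i F i).
Proof.
move=> mF tF; have h := cvg_pr_bigcup (mu := mu) mF tF.
rewrite -(cvg_lim (@Rhausdorff R) h).
apply: (@nondecreasing_cvgn_le R (fun N => \sum_(0 <= i < N) pr (F i))).
  by apply/nondecreasing_seqP => m; rewrite big_nat_recr //= lerDl pr_ge0.
by apply/cvg_ex; exists (pr (\bigcup_i F i)).
Qed.

Lemma pr_bigcup_eq (F : nat -> set X) q : (forall i, measurable (F i)) ->
  trivIset setT F -> (forall N, \sum_(0 <= i < N) pr (F i) <= q) ->
  (forall e, 0 < e -> exists N, q - e <= \sum_(0 <= i < N) pr (F i)) ->
  pr (\bigcup_i F i) = q.
Proof.
move=> mF tF hle hge; apply/eqP; rewrite eq_le pr_bigcup_le //=.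
apply/ler_addgt0Pr => e /hge[N hN]; rewrite -lerBlDr.
exact: le_trans hN (sum_pr_le _ mF tF).
Qed.

End DisjointSums.

Lemma cvg_partial_sums (R : realType) (p : nat -> R) : (forall j, 0 <= p j) ->
  (\sum_(0 <= j <oo) (p j)%:E)%E = 1%E ->
  (forall N, \sum_(0 <= j < N) p j <= 1) /\
  (forall e, 0 < e -> exists N, forall N', (N <= N')%N ->
     1 - e <= \sum_(0 <= j < N') p j).
Proof.
move=> p0 hp.
have cv : (fun N => \sum_(0 <= j < N) (p j)%:E)%E @ \oo --> 1%:E.
  by rewrite -hp; apply: is_cvg_nneseries => j _ _; rewrite lee_fin.
have cvr : (fun N => \sum_(0 <= j < N) p j) @ \oo --> (1 : R).
  move: cv => /fine_cvg; apply: cvg_trans.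
  by apply: near_eq_cvg; near=> N; rewrite /= sumEFin.
have nd : nondecreasing_seq (fun N => \sum_(0 <= j < N) p j).
  by apply/nondecreasing_seqP => m; rewrite big_nat_recr //= lerDl.
split=> [N|e e0].
  rewrite -(cvg_lim (@Rhausdorff R) cvr).
  by apply: (nondecreasing_cvgn_le nd); apply/cvg_ex; exists 1.
have [N _ hN] := (cvgrPdist_le _ _).1 cvr _ e0.
exists N => // N' NN'; have := hN N' NN'.
by move=> /(le_trans (ler_norm _)); lra.
Unshelve. all: by end_near. Qed.

Section Assembly.
Context {R : realType} {n : nat} {d : measure_display} {X : measurableType d}.
Variables (mu : probability X R) (T : 'rV[int]_n -> X -> X).
Hypothesis hT : measure_preserving_action mu T.
Variables (w : nat -> 'rV[nat]_n).
Hypothesis hw : forall j i, (0 < w j 0%R i)%N.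
Local Notation pr := (pr mu).
Local Notation tower := (tower T).

Lemma tiled_rohlin j Y : tiled T w [set j] Y -> rohlin_tower T (w j) Y.
Proof.
move=> [F [mF F0 dF ->]]; exists (F j).
have TE v : T v @` F j = [set x | F j (T (- v) x)].
  apply/seteqP; split=> [x [y Fy <-]|x Fx /=].
    by rewrite /= (actA hT) addNr (act0 hT).
  by exists (T (- v) x); rewrite ?(actA hT) ?addrN ?(act0 hT).
split=> //.
- apply/seteqP; split=> [x [j' _ [v hv Fv]]|x [v hv]].
    have [e|ne] := eqVneq j' j; first by subst j'; exists v => //; rewrite TE.
    by rewrite F0 in Fv => //; apply/eqP.
  by rewrite TE => Fv; exists j => //; exists v.
- move=> u v hu hv uv; rewrite !TE -subset0 => x [Fu Fv].
  by apply: uv; have [] := dF j j u v x hu hv Fu Fv.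
Qed.

Lemma tiled_single (F : nat -> set X) j : (forall j, measurable (F j)) ->
  disjoint_bases T w F -> tiled T w [set j] (tower (box (w j)) (F j)).
Proof.
move=> mF dF; exists (fun j' => if j' == j then F j else set0); split.
- by move=> j'; case: ifP.
- by move=> j' /= ne; case: eqP.
- move=> j1 j2 u u' x hu hu'; case: eqP => [e1|//] F1; case: eqP => [e2|//] F2.
  by subst j1 j2; exact: (dF j j u u' x).
- apply/seteqP; split=> [x h|x [j' _]]; first by exists j; rewrite ?eqxx.
  by case: eqP => [->//|_ [u _ []]].
Qed.

Lemma tiled_cube j s G : measurable G -> disjoint_tower T (cube 0 s%:Z) G ->
  (forall i, (w j 0%R i %| s)%N) -> tiled T w [set j] (tower (cube 0 s%:Z) G).
Proof.
move=> mG dG ws.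
have e : cube 0 s%:Z = ibox (const_mx 0) (const_mx s%:Z) :> set 'rV[int]_n.
  by apply/seteqP; split=> v hv i; have := hv i; rewrite !mxE.
rewrite e in dG *; apply: (@tiled_grid _ _ _ _ mu T hT w hw) => // i.
by rewrite !mxE subr0 dvdzE; exact: ws.
Qed.

End Assembly.

Lemma positive_lower_bound (R : realType) (p : nat -> R) k :
  (forall j, 0 < p j) -> exists2 c, 0 < c < 1 & forall j, (j < k)%N -> c <= p j.
Proof.
move=> p0; elim: k => [|k [c /andP[c0 c1] hc]]; first by exists (1 / 2) => //; lra.
exists (Num.min c (p k)) => [|j]; first by rewrite lt_min c0 p0 gt_min c1.
rewrite ltnS leq_eqVlt => /orP[/eqP->|/hc h]; first by rewrite ge_min lexx orbT.
by rewrite ge_min h.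
Qed.

Section HalvingSequence.
Variables (R : realType) (c : R).
Definition halving m : R := c / 2 ^+ m.+1.

Lemma halvingS m : halving m.+1 = halving m / 2.
Proof. by rewrite /halving [2 ^+ m.+2]exprSr invfM mulrA. Qed.

Lemma halving_gt0 m : 0 < c -> 0 < halving m.
Proof. by move=> c0; rewrite divr_gt0 // exprn_gt0. Qed.

Lemma sum_halving m N :
  \sum_(0 <= i < N) halving (m + i)%N = 2 * halving m - 2 * halving (m + N)%N.
Proof.
elim: N => [|N IH]; first by rewrite big_geq // addn0 subrr.
by rewrite big_nat_recr //= IH addnS halvingS; field.
Qed.

Lemma halving_le m : 0 < c -> halving m <= c.
Proof.
move=> c0; elim: m => [|m IH]; first by rewrite /halving expr1; lra.
by rewrite halvingS; have := halving_gt0 m c0; lra.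
Qed.

Lemma halving_small e : 0 < c -> 0 < e -> exists m, halving m < e.
Proof.
move=> c0 e0.
have h m : halving m <= c / m.+1%:R.
  rewrite /halving ler_pM2l // lef_pV2 ?posrE ?exprn_gt0 // -natrX ler_nat.
  exact/ltnW/ltn_expl.
exists (Num.bound (c / e)); apply: le_lt_trans (h _) _.
rewrite ltr_pdivrMr // -ltr_pdivrMl // mulrC.
have : c / e < (Num.bound (c / e))%:R by apply: archi_boundP; rewrite divr_ge0 // ltW.
by move=> /lt_le_trans; apply; rewrite ler_nat.
Qed.

End HalvingSequence.

(** The slabs give type j a measure [z j] at most p_j, nonzero only for j < k. The missing measure
    [q j] is supplied by the cubes, whose bases are split according to the allocation; at scale m
    only types j < f m receive a share. *)
Lemma multi_tower (R : realType) (n : nat)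
  (w : nat -> 'rV[nat]_n) (hw : forall j i, (0 < w j 0%R i)%N)
  (p : nat -> R) (hp : forall j, 0 < p j)
  (hgcd : forall i, is_gcd_seq (fun j => w j 0%R i) 1)
  (hsum : (\sum_(0 <= j <oo) (p j)%:E)%E = 1%E)
  (d : measure_display) (X : measurableType d) (mu : probability X R)
  (hmu : lebesgue_probability mu)
  (T : 'rV[int]_n -> X -> X)
  (hT : measure_preserving_action mu T) (hfree : free_action mu T) :
  exists tau : nat -> set X,
    [/\ forall j, tiled T w [set j] (tau j), forall j, pr mu (tau j) = p j,
        forall j j' x, tau j x -> tau j' x -> j = j' &
        pr mu (\bigcup_j tau j) = 1].
Proof.
have [M [k hMk]] := gcd_rows_sums hw hgcd.
have p_ge0 j : 0 <= p j by exact: ltW.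
have [p_le p_lim] := cvg_partial_sums p_ge0 hsum.
have [c /andP[c0 c1] hc] := positive_lower_bound k hp.
(* [e m] is the measure left outside the cubes of level m, and [r m] bounds the slabs of that level;
   the r_i with i >= m add up to e_m / 2. *)
pose e := halving c; pose r m := e m / 4.
have e0 m : 0 < e m by exact: halving_gt0.
have r0 m : 0 < r m by rewrite divr_gt0.
have e01 m : 0 < e m < 1 by rewrite e0 (le_lt_trans (halving_le m c0)).
have sum_er m N : \sum_(0 <= i < N) (e (m + i)%N + r (m + i)%N) <= 5 / 2 * e m.
  rewrite big_split /= -mulr_suml sum_halving -/e.
  by have := e0 (m + N)%N; lra.
(* The types from [f m] on have total measure at most e_m / 2. Since k <= f m, the side S_m also
   suits the types used in slabs. *)
have /choice[f hf] : forall m, exists f, (k <= f)%N /\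
    1 - e m / 2 <= \sum_(0 <= j < f) p j.
  move=> m; have [|N hN] := p_lim (e m / 2); first by rewrite divr_gt0.
  by exists (maxn k N); split; [exact: leq_maxl|apply: hN; exact: leq_maxr].
pose S m := (\prod_(j < f m) \prod_i w j 0%R i)%N.
have S0 m : (0 < S m)%N by apply: prodn_gt0 => j; exact: prodn_gt0.
have wS m j i : (j < f m)%N -> (w j 0%R i %| S m)%N.
  move=> jf; rewrite /S (bigD1 (Ordinal jf)) //=; apply: dvdn_mulr.
  by rewrite (bigD1 i) //=; exact: dvdn_mulr.
have wSJ m j i : [set j | (j < k)%N] j -> (w j 0%R i %| S m)%N.
  by move=> /= jk; apply: wS; case: (hf m) => h _; exact: leq_trans h.
have [s [G [Z [hs hG hZ [EE [ZZ EZ]] hW]]]] :=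
  cube_decomposition hT hmu hfree hw hMk S0 wSJ e01 r0.
set E := fun m => tower T (cube 0 (s m)%:Z) (G m) in EE EZ hW.
have mE m : measurable (E m) by apply: (measurable_tower hT); case: (hG m).
have mZ m : measurable (Z m) by case: (hZ m) => /(measurable_tiled hT).
pose Zall := \bigcup_m Z m.
have mZall : measurable Zall by exact: bigcup_measurable.
have tZ : trivIset setT Z.
  by apply/trivIsetP => i j _ _ /eqP ij; rewrite -subset0 => x [Zi /(ZZ _ _ _ Zi)].
have [FZ [mFZ FZ0 dFZ ZallE]] : tiled T w [set j | (j < k)%N] Zall.
  by apply: tiled_bigcup => // m; case: (hZ m).
pose zt j := tower T (box (w j)) (FZ j).
have mzt j : measurable (zt j) by exact: (measurable_tower hT).
have ztd j j' x : zt j x -> zt j' x -> j = j'.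
  by move=> [u hu Fu] [u' hu' Fu']; case: (dFZ _ _ _ _ x hu hu' Fu Fu').
have tzt : trivIset setT zt.
  by apply/trivIsetP => i j _ _ /eqP ij; rewrite -subset0 => x [Zi /(ztd _ _ _ Zi)].
pose z j := pr mu (zt j).
have z_ge0 j : 0 <= z j by exact: pr_ge0.
have z_large j : (k <= j)%N -> z j = 0.
  move=> kj; rewrite /z /zt FZ0 /=; last by apply/negP; rewrite -leqNgt.
  suff -> : tower T (box (w j)) set0 = set0 by rewrite pr0.
  by rewrite -subset0 => x [].
have sum_z_le N : \sum_(0 <= j < N) z j <= pr mu Zall.
  by rewrite ZallE; exact: sum_pr_le.
have sum_z_ge N : (k <= N)%N -> pr mu Zall <= \sum_(0 <= j < N) z j.
  move=> kN; rewrite ZallE; apply: pr_bigcup_le => // N'.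
  have mono i : \sum_(0 <= j < i) z j <= \sum_(0 <= j < N) z j.
    have [iN|/ltnW Ni] := leqP i N.
      by rewrite (big_cat_nat _ iN) //= lerDl sumr_ge0.
    rewrite (big_cat_nat _ Ni) //= gerDl big_nat big1 // => j /andP[Nj _].
    by apply: z_large; exact: leq_trans Nj.
  exact: mono.
have prZ m : pr mu Zall <= \sum_(0 <= i < m) pr mu (Z i) + e m / 2.
  apply: pr_bigcup_le => // N; have [Nm|/ltnW mN] := leqP N m.
    rewrite [X in _ <= X + _](big_cat_nat _ Nm) //= -addrA lerDl addr_ge0 //.
      by apply: sumr_ge0 => i _; exact: pr_ge0.
    by rewrite divr_ge0 // ltW.
  rewrite (big_cat_nat _ mN) //= lerD2l.
  rewrite -{1}(add0n m) big_addn.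
  apply: (@le_trans _ _ (\sum_(0 <= i < N - m) r (m + i)%N)).
    by apply: ler_sum => i _; rewrite addnC; case: (hZ (m + i)%N).
  rewrite -mulr_suml sum_halving -/e.
  by have := e0 (m + (N - m))%N; lra.
(* All slabs together have measure at most e_0 / 2, which is below c and hence below p_j. *)
have z_le j : (j < k)%N -> z j <= p j.
  move=> jk; apply: (le_trans _ (hc j jk)).
  apply: (@le_trans _ _ (pr mu Zall)).
    by apply: pr_le => //; rewrite ZallE => x; exists j.
  apply: (le_trans (prZ 0%N)); rewrite big_geq // add0r.
  by have := halving_le 0 c0; rewrite -/e; lra.
pose q j := p j - z j.
have q_ge0 j : 0 <= q j.
  rewrite subr_ge0; have [/z_le //|kj] := ltnP j k.
  by rewrite z_large.
pose cE m := pr mu (E m).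
have hW_le m : \sum_(0 <= i < m.+1) cE i + \sum_(0 <= i < m) pr mu (Z i) <= 1 - e m.
  by case: (hW m).
have hW_ge m :
    1 - 5 / 2 * e m <= \sum_(0 <= i < m.+1) cE i + \sum_(0 <= i < m) pr mu (Z i).
  by case: (hW m) => _; apply; exact: sum_er.
have sum_q N : \sum_(0 <= j < N) q j = \sum_(0 <= j < N) p j - \sum_(0 <= j < N) z j.
  by rewrite sumrB.
have [t [t_ge0 t_le tq_le tq_ge t_f]] : exists t : nat -> nat -> R,
  [/\ forall m j, 0 <= t m j, forall m N, \sum_(0 <= j < N) t m j <= cE m,
      forall j N, \sum_(0 <= m < N) t m j <= q j,
      forall j x, 0 < x -> exists N, q j - x <= \sum_(0 <= m < N) t m j &
      forall m j, (f m <= j)%N -> t m j = 0].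
  apply: allocation => //.
  - by move=> m; exact: pr_ge0.
  - move=> N x x0; have x'0 : 0 < x / (5 / 2) by lra.
    have [m hm] := halving_small c0 x'0; exists m.+1.
    (* Beyond k the partial sums of [z] account for all slabs. What the cubes then lack is at most
       5/2 e_m, which is less than x. *)
    pose N' := maxn N k.
    have h1 : \sum_(0 <= j < N) q j <= \sum_(0 <= j < N') q j.
      rewrite (big_cat_nat (n := N) (p := N')) ?leq_maxl //= lerDl.
      exact: sumr_ge0.
    have h2 := sum_z_ge N' (leq_maxr _ _).
    have h3 := p_le N'.
    have h5 := hW_ge m.
    have h4 : \sum_(0 <= i < m) pr mu (Z i) <= pr mu Zall by exact: sum_pr_le.
    rewrite -/e -/(e m) in hm; rewrite [X in _ <= X]sum_q in h1.
    by move: h1 h2 h3 h4 h5 hm; lra.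
  (* The cubes up to scale m have measure at most 1 - e_m minus the slabs before m. The later slabs
     cost at most e_m / 2, and the other e_m / 2 covers the tail of p beyond [f m]. *)
  - move=> m; have [_ h1] := hf m; have h2 := prZ m; have h3 := hW_le m.
    have h4 := sum_z_le (f m).
    by rewrite sum_q; move: h1 h2 h3 h4; lra.
have sn0 m : 0 < (s m ^ n)%:R :> R by rewrite ltr0n expn_gt0; case: (hs m) => ->.
have prtower m H : measurable H -> H `<=` G m ->
    pr mu (tower T (cube 0 (s m)%:Z) H) = (s m ^ n)%:R * pr mu H.
  move=> mH HG; have dH : disjoint_tower T (cube 0 (0 + (s m)%:Z)) H.
    by rewrite add0r; apply: disjoint_tower_sub HG (hG m).2.
  by have := pr_cube_tower hT mH dH; rewrite add0r.
(* Each base is split in proportion to the shares; dividing by the number of levels turns a share of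
   the tower into a measure of the base. *)
have /choice[B hB] : forall m, exists B : nat -> set X,
  [/\ forall j, measurable (B j), forall j, B j `<=` G m,
    forall j, pr mu (B j) = t m j / (s m ^ n)%:R,
    forall j, t m j / (s m ^ n)%:R = 0 -> B j = set0 & trivIset setT B].
  move=> m; have [mG _] := hG m; apply: (nonatomic_split hmu.2 mG).
    by move=> j; rewrite divr_ge0 // ltW.
  by move=> N; rewrite -mulr_suml ler_pdivrMr // mulrC -prtower.
pose piece m j := tower T (cube 0 (s m)%:Z) (B m j).
have mB m j : measurable (B m j) by case: (hB m).
have BG m j : B m j `<=` G m by case: (hB m) => _ h _ _ _; exact: h.
have dB m j : disjoint_tower T (cube 0 (s m)%:Z) (B m j).
  by apply: disjoint_tower_sub (BG m j) (hG m).2.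
have mpiece m j : measurable (piece m j) by exact: (measurable_tower hT).
have prpiece m j : pr mu (piece m j) = t m j.
  rewrite prtower //; case: (hB m) => _ _ -> _ _.
  by rewrite mulrC divfK // gt_eqF.
have pieceE m j : piece m j `<=` E m by exact: tower_sub.
have piece_inj m m' j j' x : piece m j x -> piece m' j' x -> m = m' /\ j = j'.
  move=> h h'; have mm' := EE _ _ x (pieceE _ _ _ h) (pieceE _ _ _ h').
  subst m'; split=> //; case: h h' => u hu Bu [u' hu' Bu'].
  have uu' : u = u'.
    by apply: ((hG m).2 _ _ x) => //; apply: (BG m); eassumption.
  subst u'; have [_ _ _ _ /trivIsetP tB] := hB m.
  have [//|/eqP ne] := eqVneq j j'.
  have : (B m j `&` B m j') (T (- u) x) by [].
  by rewrite tB //; apply/eqP.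
have tpiece m j : tiled T w [set j] (piece m j).
  (* For j < f m the sides of type j divide S_m and so the side of the cube; for other types the
     share is 0 and the piece is empty. *)
  have [jf|fj] := ltnP j (f m).
    apply: (tiled_cube hT hw) => // i.
    by apply: (@dvdn_trans (S m)); [exact: wS|case: (hs m)].
  have [_ _ _ h _] := hB m.
  have -> : piece m j = set0.
    by rewrite /piece h ?t_f ?mul0r // -subset0 => x [].
  exact: tiled0.
pose Y j := \bigcup_m piece m j.
have mY j : measurable (Y j) by exact: bigcup_measurable.
have trpiece j : trivIset setT (piece^~ j).
  apply/trivIsetP => a b _ _ /eqP ab; rewrite -subset0 => x [h1 h2].
  by have [] := piece_inj _ _ _ _ _ h1 h2.
have prY j : pr mu (Y j) = q j.
  apply: pr_bigcup_eq => // [N|x x0].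
    by under eq_bigr do rewrite prpiece; exact: tq_le.
  have [N hN] := tq_ge j x x0; exists N.
  by under eq_bigr do rewrite prpiece.
have YZ j j' x : Y j x -> ~ zt j' x.
  move=> [m _ /pieceE Ex] zx.
  have [m' _ Zx] : Zall x by rewrite ZallE; exists j'.
  exact: EZ Ex Zx.
pose tau j := zt j `|` Y j.
have ztY j : zt j `&` Y j = set0 by rewrite -subset0 => x [zx Yx]; exact: YZ Yx zx.
have mtau j : measurable (tau j) by exact: measurableU.
have prtau j : pr mu (tau j) = p j.
  by rewrite [LHS](prU mu (mzt j) (mY j) (ztY j)) prY addrC subrK.
have tau_inj j j' x : tau j x -> tau j' x -> j = j'.
  move=> [h|h] [h'|h']; first exact: ztd h h'.
  - by case: (YZ _ _ _ h' h).
  - by case: (YZ _ _ _ h h').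
  by case: h h' => m _ h [m' _ h']; case: (piece_inj _ _ _ _ _ h h').
exists tau; split=> //.
- move=> j; apply: tiledU => //; first exact: tiled_single.
  apply: tiled_bigcup => // m m' x h h'.
  by case: (piece_inj _ _ _ _ _ h h').
- apply: pr_bigcup_eq => //.
  + apply/trivIsetP => a b _ _ /eqP ab; rewrite -subset0 => x [h1 h2].
    by apply: ab; exact: tau_inj h1 h2.
  + by move=> N; under eq_bigr do rewrite prtau.
  + move=> x x0; have [N hN] := p_lim x x0; exists N.
    by under eq_bigr do rewrite prtau; exact: hN.
Qed.

Theorem theorem1p1 (R : realType) (n : nat) (hn : (1 <= n)%N)
  (w : nat -> 'rV[nat]_n) (hw : forall j i, (0 < w j 0%R i)%N)
  (p : nat -> R) (hp : forall j, 0 < p j)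
  (hgcd : forall i, is_gcd_seq (fun j => w j 0%R i) 1)
  (hsum : (\sum_(0 <= j <oo) (p j)%:E)%E = 1%E)
  (d : measure_display) (X : measurableType d) (mu : probability X R)
  (hmu : lebesgue_probability mu)
  (T : 'rV[int]_n -> X -> X)
  (hT : measure_preserving_action mu T) (hfree : free_action mu T) :
  exists tau : nat -> set X,
    [/\ (forall j, rohlin_tower T (w j) (tau j)),
        (forall j, mu (tau j) = (p j)%:E),
        (forall j j', j <> j' -> tau j `&` tau j' = set0) &
        mu.-negligible (~` \bigcup_j tau j)].
Proof.
have [tau [tile prtau tau_inj prU]] := multi_tower hw hp hgcd hsum hmu hT hfree.
have mtau j : measurable (tau j) by exact: (measurable_tiled hT (tile j)).
have mU : measurable (\bigcup_j tau j) by exact: bigcup_measurable.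
exists tau; split.
- by move=> j; exact: (tiled_rohlin hT).
- by move=> j; rewrite prE // prtau.
- move=> j j' ne; rewrite -subset0 => x [h h'].
  by apply: ne; exact: tau_inj h h'.
- exists (~` \bigcup_j tau j); split=> //; first exact: measurableC.
  apply: etrans (prE mu (measurableC mU)) _.
  by rewrite prC // prU subrr.
Qed.
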